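(* Let $p$ be a prime, let $f\in\mathbb{F}_p[X]$ with $\deg f=3$, let $R,S$ be integers and let $M$ be an integer with $1\le M<p$. Let $I_f(M;R,S)$ denote the number of integer pairs $(x,y)\in[R+1,R+M]\times[S+1,S+M]$ with $y^2\equiv f(x)\pmod p$. Then, uniformly over all such $p$, $f$, $R$, $S$, $$I_f(M;R,S)<M^{1/3+o(1)}+\frac{M^{5/3+o(1)}}{p^{1/6}}$$ as $M\to\infty$.
   Context: Elements of $\mathbb{F}_p$ are identified with the integers $\{0,1,\dots,p-1\}$ and congruences are taken modulo $p$. The notation $M^{o(1)}$ stands for $M^{\varepsilon(M)}$ where $\varepsilon(M)\to0$ as $M\to\infty$ uniformly in $p,f,R,S$; equivalently, for every $\varepsilon>0$ there is $M_0(\varepsilon)$ such that the bound with every $o(1)$ replaced by $\varepsilon$ holds whenever $M\ge M_0(\varepsilon)$. *)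

(* Defs.v *)
From mathcomp Require Import all_boot all_order all_algebra.

Set Implicit Arguments.
Unset Strict Implicit.
Unset Printing Implicit Defensive.

Import Order.TTheory GRing.Theory Num.Theory.
Local Open Scope ring_scope.

(* I_f(M; R, S): the integers of [R + 1, R + M] are the R + i.+1 with i : 'I_M,
   and likewise for [S + 1, S + M]. For p prime, the equality in 'F_p of the
   images of integers is congruence modulo p. *)
Definition box_points (p : nat) (f : {poly 'F_p}) (M : nat) (R S : int) : nat :=
  #|[set ij : 'I_M * 'I_M |
      let x := R + (ij.1).+1%:Z in
      let y := S + (ij.2).+1%:Z in
      (y%:~R : 'F_p) ^+ 2 == f.[x%:~R]]|.

(* Main.v *)
Require Import Defs.
From mathcomp Require Import all_boot all_order all_algebra.
From mathcomp Require Import all_classical all_reals all_analysis.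
From mathcomp Require Import zify ring lra.

(* Divide the range of x into intervals of length H with H^6 M^2 <= p, and show
   that each carries at most M^(1/3+o(1)) points. Centering at one of them, the
   points (u, v) give vectors (u, u^2, u^3, v, v^2) in a lattice of index p in
   Z^5, inside a box of volume O(H^6 M^3) = O(p M).
   - If these vectors span, the lattice has O(M) points in a dilated box; sums of
     three vectors have bounded multiplicity, since power sums determine a triple,
     so there are O(M^(1/3)) points.
   - Otherwise they satisfy a linear relation with integer coefficients polynomial
     in M (Siegel's lemma). Modulo p it either meets the given curve in O(1) points
     or is proportional to its equation; then all points lie on an integral curve
     d2 v^2 + d1 v + g(u) = 0 with g cubic, and the Bombieri-Pila bound M^(1/3+o(1))
     applies. The latter is proved q-adically: for a prime q slightly larger than
     M^(1/3), Hensel's lemma and the pigeonhole principle give, in each residue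
     class mod q, an auxiliary polynomial of bounded degree which vanishes mod a
     power of q at the points of the class, hence vanishes there. *)

Set Implicit Arguments.
Unset Strict Implicit.
Unset Printing Implicit Defensive.

Import Order.TTheory GRing.Theory Num.Theory.

(** * Primes in dyadic intervals *)

Lemma leq_central_bin n : 2 ^ n <= 'C(n.*2, n).
Proof.
elim: n => // n IHn; rewrite doubleS binS expnS mul2n -addnn.
apply: leq_add; apply: leq_trans IHn _; first by rewrite binS leq_addl.
exact: leq_bin2l.
Qed.

(** By Legendre's formula each power [p ^ i] adds at most one carry to the valuation of the binomial
    coefficient, and only exponents with [p ^ i <= n] contribute. *)
Lemma leq_pfactor_bin p n k : prime p -> 0 < n -> k <= n -> p ^ logn p 'C(n, k) <= n.
Proof.
move=> p_pr n_gt0 le_kn.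
have p_gt1 := prime_gt1 p_pr.
have /(congr1 (logn p)) := bin_fact le_kn.
rewrite !lognM ?muln_gt0 ?fact_gt0 ?bin_gt0 // => logE.
apply: leq_trans (trunc_logP p_gt1 n_gt0).
rewrite leq_exp2l //.
set L := trunc_log p n.
have fact_log m : m <= n -> logn p m`! = \sum_(1 <= i < L.+1) m %/ p ^ i.
  move=> le_mn; rewrite logn_fact //.
  have small i : L < i -> m %/ p ^ i = 0.
    move=> lt_Li; apply: divn_small; apply: leq_ltn_trans le_mn _.
    by apply: leq_trans (trunc_log_ltn n p_gt1) _; rewrite leq_exp2l.
  have big i : m < i -> m %/ p ^ i = 0.
    by move=> lt_mi; apply: divn_small; apply: leq_trans (ltn_expl _ p_gt1); apply: ltnW.
  have [le_mL | lt_Lm] := leqP m L.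
    rewrite [RHS](@big_cat_nat _ _ _ m.+1) ?ltnS //=.
    rewrite [X in _ = _ + X]big_nat [X in _ = _ + X]big1 ?addn0 // => i /andP[lt_mi _].
    exact: big.
  rewrite [LHS](@big_cat_nat _ _ _ L.+1) ?ltnS ?(ltnW lt_Lm) //=.
  by rewrite [X in _ + X = _]big_nat [X in _ + X = _]big1 ?addn0 // => i /andP[lt_Li _]; exact: small.
move: logE; rewrite !fact_log ?leq_subr // -!big_split /= => logE.
suff: \sum_(1 <= i < L.+1) n %/ p ^ i
   <= \sum_(1 <= i < L.+1) 1 + \sum_(1 <= i < L.+1) (k %/ p ^ i + (n - k) %/ p ^ i).
  by rewrite -logE leq_add2r sum_nat_const_nat muln1 subSS subn0.
rewrite -big_split /=; apply: leq_sum => i _.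
rewrite -{1}(subnKC le_kn) divnD ?expn_gt0 ?(prime_gt0 p_pr) //.
by rewrite addnC leq_add2r leq_b1.
Qed.

(** Chebyshev's argument: the primes are those dividing the central binomial coefficient, which is
    at least [2 ^ n] and is a product of prime powers, each at most [2 n]. *)
Lemma many_primes n : 0 < n ->
  exists s : seq nat, [/\ uniq s, all prime s, all (fun p => p <= n.*2) s
    & 2 ^ n <= n.*2 ^ size s].
Proof.
move=> n_gt0; have bin0 : 0 < 'C(n.*2, n) by rewrite bin_gt0 -addnn leq_addr.
exists (primes 'C(n.*2, n)); rewrite primes_uniq; split=> //.
- exact: all_prime_primes.
- apply/allP=> p; rewrite mem_primes => /and3P[p_pr _ p_dvd].
  rewrite leqNgt; apply/negP => lt_np.
  have: p %| (n.*2)`! by rewrite -(@bin_fact n.*2 n) ?dvdn_mulr // -addnn leq_addr.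
  rewrite -[p](expn1 p) pfactor_dvdn ?fact_gt0 // logn_fact // big_nat big1 // => i /andP[i_gt0 _].
  by apply: divn_small; apply: leq_trans lt_np _; rewrite -{1}(expn1 p) leq_exp2l ?prime_gt1.
- apply: leq_trans (leq_central_bin n) _.
  rewrite {1}(prod_prime_decomp bin0) prime_decompE big_map /=.
  rewrite [leqRHS](_ : _ = \prod_(p <- primes 'C(n.*2, n)) n.*2); last first.
    by rewrite big_const_seq count_predT iter_muln_1.
  rewrite big_seq [leqRHS]big_seq; apply: leq_prod => p; rewrite mem_primes => /and3P[p_pr _ _].
  by apply: leq_pfactor_bin; rewrite ?double_gt0 // -addnn leq_addr.
Qed.

(** The Chebyshev bound at [2 ^ m.-1] gives more than [2 ^ b + s] primes up to [2 ^ m]; at most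
    [2 ^ b + 1] of them are discarded as too small. *)
Lemma many_primes_dyadic b m s : 0 < m -> m * (2 ^ b + s).+1 <= 2 ^ m.-1 ->
  exists l : seq nat, [/\ uniq l, all prime l, all (fun p => 2 ^ b < p <= 2 ^ m) l
    & size l = s].
Proof.
case: m => // m _ /= le_m.
have [l [l_uniq l_pr l_le]] := many_primes (expn_gt0 2 m).
have -> : (2 ^ m).*2 = 2 ^ m.+1 by rewrite expnS mul2n.
rewrite -expnM leq_exp2l // => /(leq_trans le_m).
rewrite leq_pmul2l // => lt_l.
set l' := [seq p <- l | 2 ^ b < p].
have size_l' : s <= size l'.
  have := count_predC (fun p => 2 ^ b < p) l; rewrite -!size_filter -/l'.
  suff: size (seq.filter (predC (fun p => 2 ^ b < p)) l) <= (2 ^ b).+1 by lia.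
  rewrite -[leqRHS](size_iota 0); apply: uniq_leq_size; first exact: filter_uniq.
  by move=> p; rewrite mem_filter mem_iota add0n ltnS /= -leqNgt => /andP[].
have sub p : p \in take s l' -> p \in l' by apply: mem_take.
exists (take s l'); split.
- by rewrite take_uniq // filter_uniq.
- by apply/allP => p /sub; rewrite mem_filter => /andP[_ /(allP l_pr)].
- apply/allP => p /sub; rewrite mem_filter => /andP[-> /(allP l_le)].
  by rewrite expnS mul2n.
- by rewrite size_take; case: ltnP => //; lia.
Qed.

Local Open Scope ring_scope.

(** * Siegel's lemma *)

Lemma card_dffun_ord (I : finType) (h : I -> nat) :
  #|{dffun forall i : I, 'I_(h i).+1}| = (\prod_i (h i).+1)%N.
Proof.
rewrite card_dep_ffun foldrE big_map big_enum /=.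
by apply: eq_bigr => i _; rewrite card_ord.
Qed.

(** Pigeonhole on the vectors with [0 <= x i <= H i]: two of them have the same residues, and [al]
    is their difference. Bounds and moduli depend on the index because the auxiliary polynomials
    below are weighted. *)
Lemma siegel_mod (I J : finType) (H : I -> nat) (m : J -> nat) (c : J -> I -> int) :
  (forall j, 0 < m j)%N -> (\prod_j m j < \prod_i (H i).+1)%N ->
  exists al : I -> int,
    [/\ exists i, al i != 0, forall i, `|al i| <= (H i)%:Z
      & forall j, ((m j)%:Z %| \sum_i al i * c j i)%Z].
Proof.
move=> m_gt0 lt_mH.
pose D := {dffun forall i : I, 'I_(H i).+1}.
pose val_ (x : D) j := \sum_i (x i)%:Z * c j i.
pose phi (x : D) : {dffun forall j : J, 'I_(m j).-1.+1} :=
  [ffun j => inord `|(val_ x j %% (m j)%:Z)%Z|].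
have not_inj : ~ injective phi.
  move=> /leq_card; rewrite !card_dffun_ord leqNgt => /negP; apply.
  by under eq_bigr => j _ do rewrite prednK //.
have /injectivePn [x [y neq_xy eq_phi]] : ~~ injectiveb phi.
  by apply/injectiveP.
exists (fun i => (x i)%:Z - (y i)%:Z); split.
- apply/existsP; apply: contraNT neq_xy; rewrite negb_exists => /forallP eq_xy.
  apply/eqP/ffunP => i; apply/val_inj/eqP; move: (eq_xy i).
  by rewrite negbK subr_eq0 eqz_nat.
- by move=> i; have := ltn_ord (x i); have := ltn_ord (y i); lia.
- move=> j; have m0 : (m j)%:Z != 0 by have := m_gt0 j; lia.
  have bnd z : (`|(val_ z j %% (m j)%:Z)%Z| < (m j).-1.+1)%N.
    have := modz_ge0 (val_ z j) m0.
    have : (val_ z j %% (m j)%:Z)%Z < (m j)%:Z by apply: ltz_pmod; have := m_gt0 j; lia.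
    by have := m_gt0 j; lia.
  move/ffunP/(_ j)/(congr1 val): eq_phi.
  rewrite !ffunE /= !inordK // => eq_abs.
  have eq_mod : (val_ x j = val_ y j %[mod (m j)%:Z])%Z.
    by rewrite -[LHS]gez0_abs ?modz_ge0 // -[RHS]gez0_abs ?modz_ge0 // eq_abs.
  under eq_bigr => i _ do rewrite mulrBl.
  by rewrite sumrB -eqz_mod_dvd; apply/eqP.
Qed.

(** The modulus [n * B * L + 1] exceeds the absolute value of each form on the box, so divisibility
    forces vanishing. *)
Lemma siegel_kernel r n (B L : nat) (c : 'I_r -> 'I_n -> int) :
  (forall j i, `|c j i| <= L%:Z) -> ((n * B * L).+1 ^ r < B.+1 ^ n)%N ->
  exists al : 'I_n -> int,
    [/\ exists i, al i != 0, forall i, `|al i| <= B%:Z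
      & forall j, \sum_i al i * c j i = 0].
Proof.
move=> le_cL lt_rn.
have [||al [al0 al_le al_dvd]] := @siegel_mod _ _ (fun=> B) (fun=> (n * B * L).+1) c.
- by [].
- by rewrite !prod_nat_const !card_ord.
exists al; split=> // j.
have : `|\sum_i al i * c j i| <= (n * B * L)%:Z.
  apply: le_trans (ler_norm_sum _ _ _) _.
  apply: le_trans (_ : \sum_(i < n) (B * L)%:Z <= _).
    by apply: ler_sum => i _; rewrite normrM PoszM; apply: ler_pM.
  by rewrite sumr_const card_ord; lia.
have /dvdzP[t ->] := al_dvd j.
have [-> | t0] := eqVneq t 0; first by rewrite mul0r.
nia.
Qed.

(** * Auxiliary polynomials in a residue class *)

Lemma PoszX (n k : nat) : (n ^ k)%N%:Z = n%:Z ^+ k.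
Proof. by rewrite -natz natrX natz. Qed.

(** This eliminates [v] on a residue class where the derivative in [v] is a unit: a monomial in [u]
    and [v] becomes a polynomial in [u] alone modulo a power of [q]. *)
Lemma hensel_branch (q v0 d1 d2 : int) (g : {poly int}) (m : nat) :
  coprimez q (2 * d2 * v0 + d1) ->
  exists phi : {poly int}, forall u v : int,
    (q %| v - v0)%Z -> d2 * v ^+ 2 + d1 * v + g.[u] = 0 ->
    (q ^+ m.+1 %| v - phi.[u])%Z.
Proof.
move=> cop; have [[s t] /= bez] := coprimezP _ _ cop.
elim: m => [|m [phi IHm]].
  by exists v0%:P => u v dv _; rewrite expr1 hornerC.
(* A Newton step with the inverse of the derivative frozen at its value at v0. *)
exists (phi - t *: (d2 *: phi ^+ 2 + d1 *: phi + g)) => u v dv eqv.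
have dphi := IHm u v dv eqv.
have gE : g.[u] = - (d2 * v ^+ 2 + d1 * v) by rewrite -[LHS]subr0 -eqv; ring.
have -> : v - (phi - t *: (d2 *: phi ^+ 2 + d1 *: phi + g)).[u]
  = (v - phi.[u]) * (1 - t * (d2 * (v + phi.[u]) + d1)).
  by rewrite !(hornerD, hornerN, hornerZ, horner_exp) gE; ring.
rewrite exprSr dvdz_mul //.
have -> : 1 - t * (d2 * (v + phi.[u]) + d1)
  = s * q + (- t * d2) * ((v - v0) *+ 2 - (v - phi.[u])) by rewrite -bez; ring.
have dq : (q %| v - phi.[u])%Z by apply: dvdz_trans dphi; rewrite exprS dvdz_mulr.
by rewrite rpredD ?dvdz_mull // rpredB // mulr2n rpredD.
Qed.

(** Squaring avoids the halved exponent [r (r + 1) / 2]; likewise in the next lemma. *)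
Lemma prod_expn_rev q r : ((\prod_(j < r) q ^ (r - j)) ^ 2 = q ^ (r * r.+1))%N.
Proof.
elim: r => [|r IHr]; first by rewrite big_ord0.
rewrite big_ord_recl subn0 expnMn.
under eq_bigr => j _ do rewrite lift0 subSS.
by rewrite IHr -expnM -expnD; congr expn; lia.
Qed.

Lemma prod_weight M J :
  ((\prod_(x : 'I_3 * 'I_J) (3 * J * M ^ (x.2 + 2))) ^ 2
     = ((3 * J) ^ 2 * M ^ (J + 3)) ^ (3 * J))%N.
Proof.
rewrite big_split /= prod_nat_const card_prod !card_ord.
rewrite -(pair_bigA _ (fun (i : 'I_3) (j : 'I_J) => M ^ (j + 2))%N) /=.
rewrite prod_nat_const card_ord expnMn [RHS]expnMn -!expnM; congr (_ * _)%N.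
  by congr expn; rewrite mulnC.
rewrite [in LHS]mulnC expnM [in RHS]mulnA [in RHS]mulnAC expnM; congr (_ ^ 3)%N.
elim: J => [|J IHJ]; first by rewrite big_ord0.
by rewrite big_ord_recr expnMn IHJ -!expnM -expnD /=; congr expn; lia.
Qed.

(** At a point of the class the value is divisible by [q ^ r], where [r = 3 * J] is the number of
    monomials, and is smaller than [q ^ r] in absolute value; hence it is zero. *)
Lemma aux_poly_exists (q M J : nat) (u0 v0 d1 d2 : int) (g : {poly int}) :
  (0 < q)%N -> (0 < M)%N -> (0 < J)%N ->
  coprimez q (2 * d2 * v0 + d1) ->
  ((3 * J) ^ 2 * M ^ (J + 3) < q ^ (3 * J).-1)%N ->
  exists2 al : 'I_3 * 'I_J -> int, exists x, al x != 0 &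
    forall u v : int, `|u| <= M%:Z -> `|v| <= M%:Z ->
      (q %| u - u0)%Z -> (q %| v - v0)%Z ->
      d2 * v ^+ 2 + d1 * v + g.[u] = 0 ->
      \sum_x al x * (u ^+ x.1 * v ^+ x.2) = 0.
Proof.
move=> q_gt0 M_gt0 J_gt0 cop lt_q.
set r := (3 * J)%N in lt_q *.
have r_gt0 : (0 < r)%N by lia.
have [phi phiP] := hensel_branch g r.-1 cop.
(* With [u = u0 + q t], requiring [q ^ (r - j)] to divide the coefficient of
   degree j in [u - u0] makes the auxiliary polynomial vanish mod [q ^ r]. *)
pose P (x : 'I_3 * 'I_J) := ('X^(x.1) * phi ^+ x.2) \Po ('X + u0%:P).
(* With these weights, [r] terms with coefficients at most [H x] and monomials at most
   [M ^ (x.1 + x.2)] sum to less than [q ^ r]. *)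
pose w (x : 'I_3 * 'I_J) := (r * M ^ (x.1 + x.2))%N.
pose H x := ((q ^ r).-1 %/ w x)%N.
have w_gt0 x : (0 < w x)%N by rewrite muln_gt0 r_gt0 expn_gt0 M_gt0.
have [||al [al0 al_le al_dvd]] :=
  @siegel_mod _ _ H (fun j : 'I_r => q ^ (r - j))%N (fun j x => (P x)`_j).
- by move=> j; rewrite expn_gt0 q_gt0.
(* The bounds [H] contribute [q ^ (r * r)] over the product of the weights, the moduli
   [q ^ (r (r + 1) / 2)]. After squaring, the comparison reduces to the [r]-th power of [lt_q]. *)
- rewrite -ltn_sqr prod_expn_rev.
  have le_H x : (q ^ r <= (H x).+1 * (r * M ^ (x.2 + 2)))%N.
    apply: leq_trans (_ : (H x).+1 * w x <= _)%N.
      by rewrite -[leqLHS]prednK ?expn_gt0 ?q_gt0 // ltn_ceil.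
    rewrite leq_mul2l leq_mul2l leq_pexp2l ?orbT // addnC leq_add2l.
    by case: x.1.
  have : (q ^ (r * r) <= \prod_x (H x).+1 * \prod_(x : 'I_3 * 'I_J) (r * M ^ (x.2 + 2)))%N.
    rewrite -big_split /=.
    apply: leq_trans (_ : \prod_(x : 'I_3 * 'I_J) q ^ r <= _)%N; last exact: leq_prod.
    by rewrite prod_nat_const card_prod !card_ord -/r -expnM.
  rewrite -leq_sqr expnMn prod_weight -/r.
  set Q := (\prod_x (H x).+1)%N => le_Q; set W := (_ * _)%N in lt_q le_Q.
  have W_gt0 : (0 < W)%N by rewrite muln_gt0 !expn_gt0 r_gt0 M_gt0.
  rewrite -(@ltn_pmul2r (W ^ r)) ?expn_gt0 ?W_gt0 //.
  apply: leq_trans le_Q.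
  have -> : ((q ^ (r * r)) ^ 2 = (q ^ (2 * r)) ^ r)%N.
    by rewrite -!expnM; congr expn; lia.
  have -> : (q ^ (r * r.+1) = (q ^ r.+1) ^ r)%N by rewrite -expnM mulnC.
  rewrite -expnMn.
  rewrite ltn_exp2r // [(2 * r)%N](_ : _ = (r.-1 + r.+1)%N); last by lia.
  by rewrite expnD [X in (X < _)%N]mulnC ltn_pmul2r ?expn_gt0 ?q_gt0.
exists al => // u v le_u le_v du dv eqv.
have dvd_sum : ((q ^ r)%N%:Z %| \sum_x al x * (u ^+ x.1 * v ^+ x.2))%Z.
  (* Replacing [v] by [phi.[u]] in each monomial costs a multiple of [q ^ r] and leaves a polynomial
     in [u - u0]. *)
  have -> : \sum_x al x * (u ^+ x.1 * v ^+ x.2) =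
     \sum_x al x * (u ^+ x.1 * (v ^+ x.2 - phi.[u] ^+ x.2))
     + \sum_x al x * (P x).[u - u0].
    rewrite -big_split /=; apply: eq_bigr => x _.
    have -> : (P x).[u - u0] = u ^+ x.1 * phi.[u] ^+ x.2.
      by rewrite /P horner_comp hornerD hornerX hornerC subrK hornerM hornerXn horner_exp.
    by rewrite -mulrDr -mulrDr subrK.
  rewrite rpredD //.
    apply: rpred_sum => x _; apply/dvdz_mull/dvdz_mull.
    rewrite subrXX dvdz_mulr // -(prednK r_gt0).
    by have := phiP u v dv eqv; rewrite PoszX.
  have [t tE] := dvdzP du; rewrite tE.
  have -> : \sum_x al x * (P x).[t * q] = (\sum_x al x *: P x).[t * q].
    by rewrite horner_sum; apply: eq_bigr => x _; rewrite hornerZ.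
  rewrite horner_coef; apply: rpred_sum => -[j /= _] _.
  have [lt_jr | le_rj] := ltnP j r; last first.
    by rewrite dvdz_mull // exprMn dvdz_mull // PoszX dvdz_exp2l.
  have := al_dvd (Ordinal lt_jr) => /= dj.
  rewrite coef_sum; under eq_bigr => x _ do rewrite coefZ.
  rewrite -(subnK (ltnW lt_jr)) expnD PoszM dvdz_mul // exprMn dvdz_mull //.
  by rewrite PoszX.
have lt_sum : `|\sum_x al x * (u ^+ x.1 * v ^+ x.2)| < (q ^ r)%N%:Z.
  have le_term x : r%:Z * `|al x * (u ^+ x.1 * v ^+ x.2)| <= (q ^ r).-1%:Z.
    have le_e : `|u ^+ x.1 * v ^+ x.2| <= (M ^ (x.1 + x.2))%N%:Z.
      rewrite normrM !normrX expnD PoszM !PoszX.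
      by apply: ler_pM; rewrite ?exprn_ge0 // lerXn2r ?nnegrE.
    apply: le_trans (_ : r%:Z * ((H x)%:Z * (M ^ (x.1 + x.2))%N%:Z) <= _).
      by rewrite ler_wpM2l // normrM ler_pM.
    by rewrite -!PoszM lez_nat mulnCA leq_trunc_div.
  suff : r%:Z * `|\sum_x al x * (u ^+ x.1 * v ^+ x.2)| <= r%:Z * (q ^ r).-1%:Z.
    rewrite ler_pM2l // => le_s; apply: le_lt_trans le_s _.
    by rewrite ltz_nat prednK // expn_gt0 q_gt0.
  apply: le_trans (_ : r%:Z * \sum_x `|al x * (u ^+ x.1 * v ^+ x.2)| <= _).
    by rewrite ler_wpM2l // ler_norm_sum.
  rewrite mulr_sumr; apply: le_trans (ler_sum _ (fun x _ => le_term x)) _.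
  by rewrite sumr_const card_prod !card_ord -mulr_natl natz.
have [t tE] := dvdzP dvd_sum; rewrite tE in lt_sum *.
have [-> | t0] := eqVneq t 0; first by rewrite mul0r.
nia.
Qed.

(** * Intersection of the cubic with an auxiliary curve *)

Lemma size_polyM_leq (F : nzSemiRingType) (p q : {poly F}) m n :
  (size p <= m -> size q <= n -> size (p * q)%R <= (m + n).-1)%N.
Proof.
move=> le_p le_q; apply: leq_trans (size_polyMleq _ _) _.
by rewrite -!subn1 leq_sub2r ?leq_add.
Qed.

(** This is the norm of [a + b v] down to rational functions of [u], where [v ^ 2 + e v = g]. The
    degree of [a ^ 2] is even and that of [b ^ 2 g] is odd, while the cross term stays below the
    larger of the two, so nothing cancels the leading term. *)
Lemma norm_neq0 (F : fieldType) (e : F) (a b g : {poly F}) :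
  size g = 4%N -> (a != 0) || (b != 0) -> a ^+ 2 - (e *: (a * b) + b ^+ 2 * g) != 0.
Proof.
move=> size_g; have g0 : g != 0 by rewrite -size_poly_gt0 size_g.
have [-> | b0] := eqVneq b 0.
  by rewrite orbF mulr0 scaler0 expr0n /= mul0r addr0 subr0; apply: expf_neq0.
have [-> _ | a0 _] := eqVneq a 0.
  by rewrite mul0r scaler0 add0r expr0n /= sub0r oppr_eq0 mulf_neq0 ?expf_neq0.
pose sA := size a; pose sB := size b.
have sa : (0 < sA)%N by rewrite size_poly_gt0.
have sb : (0 < sB)%N by rewrite size_poly_gt0.
have size_a2 : size (a ^+ 2) = (sA + sA).-1 by rewrite expr2 size_mul.
have size_b2 : size (b ^+ 2) = (sB + sB).-1 by rewrite expr2 size_mul.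
have size_b2g : size (b ^+ 2 * g) = (sB + sB + 2)%N.
  by rewrite size_mul ?expf_neq0 // size_b2 size_g; lia.
have size_ab : (size (e *: (a * b))%R <= (sA + sB).-1)%N.
  by apply: leq_trans (size_scale_leq _ _) _; rewrite size_mul.
rewrite -size_poly_gt0.
have [le_ba | lt_ab] := leqP sB.+2 sA.
  rewrite size_polyDl ?size_a2 ?size_polyN; first by lia.
  apply: leq_ltn_trans (size_polyD _ _) _.
  rewrite gtn_max size_b2g; apply/andP; split; last by lia.
  by apply: leq_ltn_trans size_ab _; lia.
have size_sum : size (e *: (a * b) + b ^+ 2 * g) = (sB + sB + 2)%N.
  by rewrite addrC size_polyDl size_b2g //; apply: leq_ltn_trans size_ab _; lia.
by rewrite addrC size_polyDl size_polyN size_sum ?size_a2; lia.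
Qed.

Section Reduction.

Variables (F : fieldType) (e : F) (g : {poly F}).
Hypothesis size_g : size g = 4%N.

(* [v ^+ j = (red j).1 + (red j).2 * v] modulo [v ^+ 2 = g - e v]. *)
Definition red (j : nat) : {poly F} * {poly F} :=
  iter j (fun ab => (ab.2 * g, ab.1 - e *: ab.2)) (1, 0).

Lemma redS j : red j.+1 = ((red j).2 * g, (red j).1 - e *: (red j).2).
Proof. by []. Qed.

Lemma redE u v j : v ^+ 2 + e * v = g.[u] -> v ^+ j = (red j).1.[u] + (red j).2.[u] * v.
Proof.
move=> eqv; elim: j => [|j IHj]; first by rewrite expr0 /= !hornerC mul0r addr0.
by rewrite exprS IHj redS /= hornerM -eqv hornerD hornerN hornerZ; ring.
Qed.

Let g0 : g != 0. Proof. by rewrite -size_poly_gt0 size_g. Qed.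

Lemma coef_g n : (3 < n)%N -> g`_n = 0.
Proof. by move=> lt_n; rewrite nth_default // size_g. Qed.

(** Give [u] weight 2 and [v] weight 3, so that [v ^ j] has weight [3 * j]: neither part of [red j]
    exceeds it, and the part of the right parity attains it. The shift by 3 accounts for the factor
    [v] of the second part. *)
Lemma red_coef j :
  [/\ forall n, (3 * j < 2 * n)%N -> (red j).1`_n = 0,
      forall n, (3 * j < 2 * n + 3)%N -> (red j).2`_n = 0,
      forall n, (3 * j = 2 * n)%N -> (red j).1`_n != 0
    & forall n, (3 * j = 2 * n + 3)%N -> (red j).2`_n != 0].
Proof.
elim: j => [|j [IHa IHb IHla IHlb]].
  split=> n /=; rewrite muln0.
  - by rewrite coefC; case: n.
  - by rewrite coef0.
  - by rewrite coefC; case: n => // _; rewrite oner_eq0.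
  - by lia.
rewrite redS /=; split=> n lt_n.
- rewrite coefM big1 // => -[i /= lt_i] _.
  have [lt_ji | le_ij] := ltnP (3 * j) (2 * i + 3); first by rewrite IHb // mul0r.
  by rewrite coef_g ?mulr0 //; lia.
- by rewrite coefB coefZ IHa ?IHb ?mulr0 ?subr0 //; lia.
- have le3n : (3 <= n)%N by lia.
  rewrite coefM (bigD1 (inord (n - 3))) //= big1 ?addr0 => [|[i /= lt_i] neq_i].
    rewrite inordK ?subKn //; last by lia.
    rewrite mulf_neq0 ?IHlb //; first by lia.
    by move: g0; rewrite -lead_coef_eq0 lead_coefE size_g.
  have [lt_ji | le_ij] := ltnP (3 * j) (2 * i + 3); first by rewrite IHb // mul0r.
  rewrite coef_g ?mulr0 //.
  suff : i <> (n - 3)%N by lia.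
  by move=> eq_i; case/eqP: neq_i; apply: val_inj; rewrite /= inordK //; lia.
- by rewrite coefB coefZ IHb ?mulr0 ?subr0 ?IHla //; lia.
Qed.

Variables (J : nat) (al : 'I_3 * 'I_J -> F).

Let a := \sum_x al x *: ('X^(x.1) * (red x.2).1).
Let b := \sum_x al x *: ('X^(x.1) * (red x.2).2).

(* The pole order of [u ^+ i * v ^+ j] at infinity: distinct monomials with
   [i < 3] have distinct orders. *)
Let wt (x : 'I_3 * 'I_J) := (2 * x.1 + 3 * x.2)%N.

(** The monomial of largest pole order among those with nonzero coefficient has a leading term which
    no other monomial cancels. It shows up in [b] or in [a] according to the parity of its exponent
    of [v]. *)
Lemma red_neq0 : (exists x, al x != 0) -> (a != 0) || (b != 0).
Proof.
case=> x0 alx0.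
have [x [alx max_x]] : exists x : 'I_3 * 'I_J,
    al x != 0 /\ forall y : 'I_3 * 'I_J, al y != 0 -> (wt y <= wt x)%N.
  by have [x alx max_x] := @arg_maxnP _ x0 (fun x => al x != 0) wt alx0; exists x.
have wt_lt (y : 'I_3 * 'I_J) : y != x -> al y != 0 -> (wt y < wt x)%N.
  move=> neq_yx /max_x; rewrite leq_eqVlt => /orP[/eqP eq_wt|//].
  case/eqP: neq_yx; move: eq_wt; rewrite /wt.
  case: x y {alx max_x} => [i j] [i' j'] /= eq_wt.
  have := ltn_ord i; have := ltn_ord i'; move=> lt_i lt_i'.
  by congr pair; apply: val_inj => /=; lia.
have coef_shift n (i : nat) (p : {poly F}) :
  ('X^i * p)`_n = if (n < i)%N then 0 else p`_(n - i) by rewrite coefXnM.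
have [Ha Hb La Lb] := red_coef x.2.
have [odd_x | even_x] := boolP (odd x.2).
  apply/orP; right; pose n := (x.1 + 3 * x.2./2)%N.
  have wt_n : (2 * n + 3 = wt x)%N.
    rewrite /n /wt; have := odd_double_half x.2; rewrite odd_x; lia.
  suff : b`_n != 0 by apply: contraNneq => ->; rewrite coef0.
  rewrite coef_sum (bigD1 x) //= big1 ?addr0 => [|y neq_y].
    rewrite coefZ mulf_neq0 // coef_shift; rewrite /wt in wt_n.
    by case: ltnP => [|le_n]; [lia | apply: Lb; lia].
  have [-> | aly] := eqVneq (al y) 0; first by rewrite scale0r coef0.
  have := wt_lt y neq_y aly; rewrite -wt_n /wt => lt_y.
  have [_ Hb' _ _] := red_coef y.2.
  by rewrite coefZ coef_shift; case: ltnP => le_n; rewrite ?mulr0 // Hb' ?mulr0 //; lia.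
apply/orP; left; pose n := (x.1 + 3 * x.2./2)%N.
have wt_n : (2 * n = wt x)%N.
  by rewrite /n /wt; have := odd_double_half x.2; rewrite (negPf even_x); lia.
suff : a`_n != 0 by apply: contraNneq => ->; rewrite coef0.
rewrite coef_sum (bigD1 x) //= big1 ?addr0 => [|y neq_y].
  rewrite coefZ mulf_neq0 // coef_shift; rewrite /wt in wt_n.
  by case: ltnP => [|le_n]; [lia | apply: La; lia].
have [-> | aly] := eqVneq (al y) 0; first by rewrite scale0r coef0.
have := wt_lt y neq_y aly; rewrite -wt_n /wt => lt_y.
have [Ha' _ _ _] := red_coef y.2.
by rewrite coefZ coef_shift; case: ltnP => le_n; rewrite ?mulr0 // Ha' ?mulr0 //; lia.
Qed.

(** The auxiliary polynomial reduces to [a + b v], and [N] is its norm, which vanishes at every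
    point of the curve where [a + b v] does. *)
Lemma elimination : (exists x, al x != 0) ->
  exists N : {poly F}, [/\ N != 0, (size N <= 4 * J + 8)%N &
    forall u v, v ^+ 2 + e * v = g.[u] -> \sum_x al x * (u ^+ x.1 * v ^+ x.2) = 0 ->
      root N u].
Proof.
move=> al0; exists (a ^+ 2 - (e *: (a * b) + b ^+ 2 * g)); split.
- exact: norm_neq0 (red_neq0 al0).
- have size_ab c : (forall x : 'I_3 * 'I_J, (size (c x : {poly F}) <= 2 * x.2 + 1)%N) ->
      (size (\sum_x al x *: ('X^(x.1) * c x))%R <= 2 * J + 1)%N.
    move=> size_c; apply: leq_trans (size_sum _ _ _) _; apply/bigmax_leqP => -[i j] _.
    apply: leq_trans (size_scale_leq _ _) _; apply: leq_trans (size_polyMleq _ _) _.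
    rewrite size_polyXn /=; have /= := size_c (i, j).
    by have := ltn_ord i; have := ltn_ord j; lia.
  have size_a : (size a <= 2 * J + 1)%N.
    apply: size_ab => x; apply/leq_sizeP => n le_n.
    by have [-> //] := red_coef x.2; lia.
  have size_b : (size b <= 2 * J + 1)%N.
    apply: size_ab => x; apply/leq_sizeP => n le_n.
    by have [_ -> //] := red_coef x.2; lia.
  apply: leq_trans (size_polyD _ _) _; rewrite size_polyN geq_max; apply/andP; split.
    by rewrite expr2; apply: leq_trans (size_polyM_leq size_a size_a) _; lia.
  apply: leq_trans (size_polyD _ _) _; rewrite geq_max; apply/andP; split.
    apply: leq_trans (size_scale_leq _ _) _.
    by apply: leq_trans (size_polyM_leq size_a size_b) _; lia.
  rewrite expr2; apply: leq_trans (size_polyM_leq (size_polyM_leq size_b size_b) _) _.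
    by rewrite size_g.
  by lia.
- move=> u v eqv sum0.
  have ab0 : a.[u] + b.[u] * v = 0.
    rewrite -[RHS]sum0 !horner_sum mulr_suml -big_split /=.
    apply: eq_bigr => x _.
    by rewrite (redE x.2 eqv) !hornerZ !hornerM !hornerXn; ring.
  rewrite /root !(hornerD, hornerN, hornerZ, hornerM, horner_exp) -eqv.
  have -> : a.[u] = - (b.[u] * v) by apply/eqP; rewrite -addr_eq0 ab0.
  by apply/eqP; ring.
Qed.

End Reduction.

(** * The Bombieri-Pila bound *)

Lemma size_fibers (T1 T2 : eqType) (f : T1 -> T2) (C : nat) (s : seq T1) (t : seq T2) :
  (forall x, x \in s -> f x \in t) ->
  (forall y, y \in t -> size [seq x <- s | f x == y] <= C)%N ->
  (size s <= C * size t)%N.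
Proof.
elim: t s => [|y t IHt] s sub_t le_C; first by case: s sub_t {le_C} => // x s /(_ x (mem_head _ _)).
have /= := count_predC (fun x => f x == y) s; rewrite -!size_filter => <-.
rewrite mulnS leq_add ?le_C ?mem_head //; apply: IHt => [x|z tz].
  by rewrite mem_filter /= => /andP[neq_xy /sub_t]; rewrite inE (negPf neq_xy).
apply: leq_trans (le_C z _); last by rewrite inE tz orbT.
by rewrite -filter_predI !size_filter; apply: sub_count => x /= /andP[].
Qed.

Lemma plane_count (F : idomainType) (s : seq (F * F)) (N : {poly F}) (Q : F -> {poly F}) :
  uniq s -> N != 0 -> (forall x, x \in s -> root N x.1) ->
  (forall x, x \in s -> [/\ Q x.1 != 0, (size (Q x.1) <= 3)%N & root (Q x.1) x.2]) ->
  (size s <= 2 * (size N).-1)%N.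
Proof.
move=> s_uniq N0 rootN rootQ; pose t := undup [seq x.1 | x <- s].
apply: leq_trans (_ : 2 * size t <= _)%N.
  apply: (@size_fibers _ _ fst) => [x sx|y]; first by rewrite mem_undup map_f.
  rewrite mem_undup => /mapP[z sz ->].
  have [Q0 size_Q _] := rootQ _ sz.
  rewrite -ltnS; apply: leq_trans size_Q.
  rewrite -(size_map snd); apply: max_poly_roots => //.
    apply/allP=> v /mapP[x]; rewrite mem_filter => /andP[/eqP eq_x sx] ->.
    by have [_ _] := rootQ _ sx; rewrite eq_x.
  rewrite map_inj_in_uniq ?filter_uniq // => -[x1 x2] [y1 y2].
  by rewrite !mem_filter /= => /andP[/eqP-> _] /andP[/eqP-> _] ->.
rewrite leq_mul2l /= -ltnS prednK ?size_poly_gt0 //.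
apply: max_poly_roots (undup_uniq _) => //.
by apply/allP=> u; rewrite mem_undup => /mapP[x sx ->]; apply: rootN.
Qed.

Section Quadratic.
Variables (F : idomainType) (c2 c1 c0 : F).
Hypothesis c2_neq0 : c2 != 0.
Let Q := c2 *: 'X^2 + c1 *: 'X + c0%:P.
Lemma coef_quadratic : Q`_2 = c2.
Proof. by rewrite !coefD !coefZ coefXn coefX coefC /= mulr1 mulr0 !addr0. Qed.
Lemma quadratic_neq0 : Q != 0.
Proof. by apply: contraNneq c2_neq0 => Q0; rewrite -coef_quadratic Q0 coef0. Qed.
Lemma size_quadratic : (size Q <= 3)%N.
Proof.
apply/leq_sizeP => -[|[|[|n]]] // _.
by rewrite !coefD !coefZ coefXn coefX coefC /= !mulr0 !addr0.
Qed.
Lemma root_quadratic x : root Q x = (c2 * x ^+ 2 + c1 * x + c0 == 0).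
Proof. by rewrite /root !(hornerD, hornerZ, hornerC, hornerX, hornerXn). Qed.
End Quadratic.

Lemma class_bound (q M J : nat) (u0 v0 d1 d2 : int) (g : {poly int}) (s : seq (int * int)) :
  (0 < q)%N -> (0 < M)%N -> (0 < J)%N -> d2 != 0 -> size g = 4%N ->
  coprimez q (2 * d2 * v0 + d1) ->
  ((3 * J) ^ 2 * M ^ (J + 3) < q ^ (3 * J).-1)%N ->
  uniq s ->
  (forall x, x \in s -> [/\ `|x.1| <= M%:Z, `|x.2| <= M%:Z,
     (q %| x.1 - u0)%Z, (q %| x.2 - v0)%Z & d2 * x.2 ^+ 2 + d1 * x.2 + g.[x.1] = 0]) ->
  (size s <= 2 * (4 * J + 8))%N.
Proof.
move=> q_gt0 M_gt0 J_gt0 d2_neq0 size_g cop lt_q s_uniq sP.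
have [al al0 alP] := @aux_poly_exists q M J u0 v0 d1 d2 g q_gt0 M_gt0 J_gt0 cop lt_q.
have d2r : d2%:~R != 0 :> rat by rewrite intr_eq0.
(* Dividing by [d2] makes the equation monic in [v], as the elimination requires; hence the passage
   to [rat]. *)
pose e : rat := d1%:~R / d2%:~R.
pose g' : {poly rat} := (- d2%:~R^-1) *: map_poly intr g.
have size_g' : size g' = 4%N.
  rewrite size_scale ?oppr_eq0 ?invr_eq0 // size_map_inj_poly //; exact: intr_inj.
have [|N [N0 size_N NP]] := @elimination _ e g' size_g' J (fun x => (al x)%:~R).
  by have [x alx] := al0; exists x; rewrite intr_eq0.
pose s' := [seq ((x.1)%:~R : rat, (x.2)%:~R : rat) | x <- s].
rewrite -(size_map (fun x => ((x.1)%:~R : rat, (x.2)%:~R : rat)) s) -/s'.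
apply: leq_trans (_ : 2 * (size N).-1 <= _)%N; last by lia.
have curve x : x \in s -> (x.2%:~R : rat) ^+ 2 + e * x.2%:~R = g'.[x.1%:~R].
  move=> /sP[_ _ _ _ /(congr1 (intr : int -> rat)) eqx].
  apply: (mulfI d2r); rewrite /g' hornerZ horner_map /= mulrA mulrN mulfV // mulN1r.
  move: eqx; rewrite !(rmorphD, rmorphM, rmorphXn) /= => /eqP; rewrite addr_eq0 => /eqP <-.
  by rewrite mulrDr /e; congr (_ + _); rewrite mulrA mulrCA mulfV ?mulr1.
apply: (@plane_count _ _ _ (fun u => 1 *: 'X^2 + e *: 'X + (- g'.[u])%:P)) => //.
- by rewrite map_inj_uniq // => -[x1 x2] [y1 y2] /= [/intr_inj-> /intr_inj->].
- move=> _ /mapP[x sx ->] /=; apply: NP (curve x sx) _.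
  have [le_u le_v du dv eqx] := sP _ sx.
  have /(congr1 (intr : int -> rat)) := alP _ _ le_u le_v du dv eqx.
  rewrite rmorph_sum /= => sum0; rewrite -[RHS]sum0; apply: eq_bigr => i _.
  by rewrite !(rmorphM, rmorphXn).
- move=> _ /mapP[x sx ->] /=; rewrite quadratic_neq0 ?size_quadratic ?oner_eq0 //.
  by rewrite root_quadratic mul1r curve // subrr.
Qed.

(** As [q] does not divide [d2], the reduced curve has at most two points above each [u] mod [q], so
    the points fall into at most [2 * q] residue classes, each subject to [class_bound]. *)
Lemma prime_bound (q M J : nat) (d1 d2 : int) (g : {poly int}) (s : seq (int * int)) :
  prime q -> (0 < M)%N -> (0 < J)%N -> ~~ (q %| d2)%Z -> size g = 4%N ->
  ((3 * J) ^ 2 * M ^ (J + 3) < q ^ (3 * J).-1)%N ->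
  uniq s ->
  (forall x, x \in s -> [/\ `|x.1| <= M%:Z, `|x.2| <= M%:Z,
     ~~ (q %| 2 * d2 * x.2 + d1)%Z & d2 * x.2 ^+ 2 + d1 * x.2 + g.[x.1] = 0]) ->
  (size s <= 2 * (4 * J + 8) * (2 * q))%N.
Proof.
move=> q_pr M_gt0 J_gt0 qd2 size_g lt_q s_uniq sP.
have q_gt0 := prime_gt0 q_pr.
have dvd_Fp k : (q %| k)%Z = (k%:~R == 0 :> 'F_q) by rewrite (dvdz_pcharf (pchar_Fp q_pr)).
have d2_neq0 : d2 != 0 by apply: contraNneq qd2 => ->; rewrite dvdz0.
pose f (x : int * int) : 'F_q * 'F_q := (x.1%:~R, x.2%:~R).
pose t := undup [seq f x | x <- s].
have size_t : (size t <= 2 * q)%N.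
  rewrite -[X in (_ <= 2 * X)%N](card_Fp q_pr) cardE.
  apply: (@size_fibers _ _ fst) => [x _|y _]; first by rewrite mem_enum.
  pose Q := d2%:~R *: 'X^2 + d1%:~R *: 'X + ((map_poly intr g).[y])%:P : {poly 'F_q}.
  rewrite -ltnS; apply: leq_trans (_ : size Q <= 3)%N; last exact: size_quadratic.
  rewrite -(size_map snd); apply: max_poly_roots.
  - by apply: quadratic_neq0; rewrite -dvd_Fp.
  - apply/allP=> v /mapP[x]; rewrite mem_filter => /andP[/eqP eq_x].
    rewrite mem_undup => /mapP[z sz xE] ->; rewrite root_quadratic.
    have [_ _ _ /(congr1 (intr : int -> 'F_q)) eqz] := sP _ sz.
    rewrite -eq_x xE /= horner_map -!rmorphXn -!rmorphM -!rmorphD /=.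
    by rewrite eqz.
  - rewrite map_inj_in_uniq ?filter_uniq ?undup_uniq // => -[x1 x2] [y1 y2].
    by rewrite !mem_filter /= => /andP[/eqP-> _] /andP[/eqP-> _] ->.
apply: leq_trans (leq_mul (leqnn _) size_t).
apply: (@size_fibers _ _ f) => [x sx|y]; first by rewrite mem_undup map_f.
rewrite mem_undup => /mapP[[u0 v0] sx0 ->].
have [_ _ /= ndvd _] := sP _ sx0.
apply: (@class_bound q M J u0 v0 d1 d2 g) => //.
- by rewrite /coprimez /gcdz -[(gcdn _ _)%:Z == 1]/(coprime _ _) prime_coprime.
- exact: filter_uniq.
- move=> x; rewrite mem_filter => /andP[/eqP[eq1 eq2] sx].
  have [le_u le_v _ eqx] := sP _ sx; split=> //; rewrite dvd_Fp rmorphB /= ?eq1 ?eq2 subrr //.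
Qed.

Lemma linear_leq_expn A k : (4 * A <= k)%N -> (A * k.+1 <= 2 ^ k)%N.
Proof.
move=> le_Ak.
have sqr_le n : (n.+1 ^ 2 <= 4 * 2 ^ n)%N.
  elim: n => [|[|[|n]] IHn] //; rewrite expnS mulnCA.
  by apply: leq_trans (leq_mul (leqnn 2) IHn); rewrite -!mulnn; nia.
by have := sqr_le k; rewrite -mulnn; nia.
Qed.

(** Here [2 ^ b] is at least [M ^ ((e + 1) / (3 e))], slightly above the cube root, and [2 ^ m] is
    at most a constant times [M ^ ((e + 2) / (3 e))]; powers [3 * e] keep this in integers. The
    spare factor [M ^ (1 / (3 e))] makes room for [t] primes in between. *)
Lemma dyadic_scale (e t : nat) : (0 < e)%N ->
  exists M0, forall M, (M0 <= M)%N -> exists b m : nat,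
    [/\ (M ^ e.+1 <= (2 ^ b) ^ (3 * e))%N,
        ((2 ^ m) ^ (3 * e) <= 2 ^ (7 * e + 1) * M ^ (e + 2))%N,
        (0 < m)%N & (m * (2 ^ b + t).+1 <= 2 ^ m.-1)%N].
Proof.
move=> e_gt0; pose A := (9 * e * t.+2)%N; pose k0 := (4 * A)%N.
exists (2 ^ (3 * e * k0))%N => M le_M.
pose l := trunc_log 2 M.
have M_gt0 : (0 < M)%N by apply: leq_trans le_M; rewrite expn_gt0.
have le_l : (2 ^ l <= M)%N by apply: trunc_logP.
have lt_l : (M < 2 ^ l.+1)%N by apply: trunc_log_ltn.
pose k := (l %/ (3 * e))%N.
pose b := ((e.+1 * l.+1) %/ (3 * e)).+1.
exists b, (b + k.+1)%N.
have e3 : (0 < 3 * e)%N by lia.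
have le_b : (e.+1 * l.+1 <= b * (3 * e))%N by rewrite ltnW // ltn_ceil.
have ge_b : ((b.-1) * (3 * e) <= e.+1 * l.+1)%N by rewrite leq_trunc_div.
have lt_k : (l < k.+1 * (3 * e))%N by rewrite ltn_ceil.
have ge_k : (k * (3 * e) <= l)%N by rewrite leq_trunc_div.
have le_k0 : (k0 <= k)%N.
  by rewrite leq_divRL // mulnC; apply: trunc_log_max.
split.
- rewrite -expnM; apply: leq_trans (_ : (2 ^ l.+1) ^ e.+1 <= _)%N.
    by rewrite leq_exp2r // ltnW.
  by rewrite -expnM leq_exp2l // mulnC.
- rewrite -expnM; apply: leq_trans (_ : 2 ^ (7 * e + 1) * (2 ^ l) ^ (e + 2) <= _)%N.
    by rewrite -expnM -expnD leq_exp2l //; rewrite /= in ge_b; nia.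
  by rewrite leq_mul2l leq_exp2r ?le_l ?orbT //; lia.
- by rewrite addnS.
- rewrite addnS /= expnD mulnC.
  apply: leq_trans (_ : (2 ^ b * t.+2) * (b + k).+1 <= _)%N.
    rewrite leq_mul2r; apply/orP; right.
    have : (0 < 2 ^ b)%N by rewrite expn_gt0.
    by nia.
  rewrite -mulnA leq_mul2l; apply/orP; right.
  apply: leq_trans (linear_leq_expn le_k0).
  rewrite /A mulnAC [(9 * e * _)%N]mulnC mulnC leq_mul2r; apply/orP; right.
  rewrite /= in ge_b; nia.
Qed.

Lemma prod_primes_dvd (l : seq nat) n :
  uniq l -> all prime l -> (forall q, q \in l -> q %| n)%N -> (\prod_(q <- l) q %| n)%N.
Proof.
elim: l => [|q l IHl] /=; first by rewrite big_nil dvd1n.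
move=> /andP[ql l_uniq] /andP[q_pr l_pr] dvd_n; rewrite big_cons Gauss_dvd.
  rewrite dvd_n ?mem_head //=; apply: IHl => // q' l_q'.
  by apply: dvd_n; rewrite inE l_q' orbT.
rewrite prime_coprime // Euclid_dvd_prod // big_has; apply: contra ql.
move=> /hasP[q' l_q']; have q'_pr := allP l_pr _ l_q'.
by rewrite dvdn_prime2 // => /eqP->.
Qed.

(** Otherwise the product of the primes of [l] would divide [n], although it is larger than [n] in
    absolute value. *)
Lemma exists_good_prime (l : seq nat) (X : nat) (n : int) :
  uniq l -> all prime l -> (forall q, q \in l -> X < q)%N -> n != 0 ->
  (`|n| < X ^ size l)%N -> exists2 q, q \in l & ~~ (q %| n)%Z.
Proof.
move=> l_uniq l_pr lt_X n0; rewrite ltnNge => /negP lt_n.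
have [/hasP[q lq ndvd] | /hasPn dvd] := boolP (has (fun q : nat => ~~ (q %| n)%Z) l).
  by exists q.
case: lt_n; apply: leq_trans (dvdn_leq _ (prod_primes_dvd l_uniq l_pr _)).
- rewrite (_ : X ^ size l = \prod_(q <- l) X)%N; last first.
    by rewrite big_const_seq count_predT iter_muln_1.
  rewrite big_seq [leqRHS]big_seq; apply: leq_prod => q /lt_X; apply: ltnW.
- by rewrite absz_gt0.
- by move=> q /dvd; rewrite negbK.
Qed.

Lemma bombieri_pila (e c0 : nat) : (0 < e)%N ->
  exists C M0, forall M, (M0 <= M)%N -> forall (d1 d2 : int) (g : {poly int}) s,
    size g = 4%N -> d2 != 0 ->
    `|d1| <= (c0 * M ^ 12)%N%:Z -> `|d2| <= (c0 * M ^ 12)%N%:Z ->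
    uniq s ->
    (forall x, x \in s -> [/\ `|x.1| <= M%:Z, `|x.2| <= M%:Z
      & d2 * x.2 ^+ 2 + d1 * x.2 + g.[x.1] = 0]) ->
    exists Z, (Z ^ (3 * e) <= C * M ^ (e + 2))%N /\ (size s <= C * Z)%N.
Proof.
(* 78 primes suffice: each exceeds [M ^ (1/3)], while [d2 * Y x] below is nonzero
   and [O(M ^ 25)], so that one of them does not divide it. *)
move=> e_gt0; have [M1 M1P] := @dyadic_scale e 78 e_gt0.
(* This [J] is large enough that [q ^ (3 * J).-1] beats [M ^ (J + 3)] for [q] above
   [M ^ ((e + 1) / (3 e))]. The successor in [exponent] leaves one spare factor [M], which absorbs
   the constant [D]. *)
pose J := (4 * e + 1)%N.
have exponent : (((J + 3) * (3 * e)).+1 <= e.+1 * (3 * J).-1)%N.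
  by rewrite /J (_ : (3 * (4 * e + 1)).-1 = 12 * e + 2)%N; lia.
have J_gt0 : (0 < (3 * J).-1)%N by rewrite /J; lia.
pose D := ((3 * J) ^ 2)%N.
pose A := (3 * (c0 * c0))%N.
pose c := (2 * (4 * J + 8) * 2)%N.
exists (2 ^ (7 * e + 1) + 6 + 78 * c)%N, (M1 + D ^ (3 * e) + A + 1)%N.
move=> M le_M d1 d2 g s size_g d2_neq0 le_d1 le_d2 s_uniq sP.
have [|b [m [le_b le_m m_gt0 le_mb]]] := M1P M.
  by apply: leq_trans le_M; rewrite -!addnA leq_addr.
have [l [l_uniq l_pr l_le size_l]] := many_primes_dyadic m_gt0 le_mb.
have M_gt0 : (0 < M)%N by apply: leq_trans le_M; rewrite addn1.
have le_DM : (D ^ (3 * e) <= M)%N.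
  by apply: leq_trans le_M; rewrite -!addnA addnCA leq_addr.
have lt_AM : (A < M)%N.
  by apply: leq_trans le_M; rewrite addn1 ltnS leq_addl.
have le_b3 : (M <= (2 ^ b) ^ 3)%N.
  rewrite -(@leq_exp2r _ _ e) // -expnM; apply: leq_trans le_b.
  by rewrite leq_pexp2l.
exists (2 ^ m)%N; split.
  by apply: leq_trans le_m _; rewrite leq_mul2r -addnA leq_addr orbT.
pose Y (x : int * int) := 2 * d2 * x.2 + d1.
have := count_predC (fun x => Y x == 0) s; rewrite -!size_filter => <-.
(* Where the derivative [Y] vanishes, so does the discriminant [d1 ^ 2 - 4 d2 g(u)]. It is cubic,
   giving at most three values of [u] with two points each. *)
have size_Y0 : (size [seq x <- s | Y x == 0] <= 6)%N.
  have g3 : g`_3 != 0 by have := lead_coef_eq0 g; rewrite lead_coefE size_g => ->; rewrite -size_poly_gt0 size_g.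
  have size_h : (size ((d1 ^+ 2)%:P - (4 * d2) *: g)%R = 4)%N.
    rewrite addrC size_polyDl size_polyN size_scale ?mulf_neq0 // size_g //.
    by apply: leq_ltn_trans (size_polyC_leq1 _) _.
  rewrite (_ : 6 = 2 * (size ((d1 ^+ 2)%:P - (4 * d2) *: g)%R).-1)%N; last by rewrite size_h.
  apply: (@plane_count _ _ _ (fun u => d2 *: 'X^2 + d1 *: 'X + (g.[u])%:P)).
  - exact: filter_uniq.
  - by rewrite -size_poly_gt0 size_h.
  - move=> x; rewrite mem_filter => /andP[/eqP Y0 /sP[_ _ eqx]].
    rewrite /root hornerD hornerN hornerC hornerZ.
    have -> : g.[x.1] = - (d2 * x.2 ^+ 2 + d1 * x.2) by rewrite -[LHS]subr0 -eqx; ring.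
    rewrite (_ : _ - _ = Y x ^+ 2); last by rewrite /Y; ring.
    by rewrite Y0 expr0n.
  - move=> x; rewrite mem_filter => /andP[_ /sP[_ _ eqx]].
    by rewrite quadratic_neq0 ?size_quadratic // root_quadratic eqx.
have Z_gt0 : (0 < 2 ^ m)%N by rewrite expn_gt0.
suff : (size (seq.filter (predC (fun x => Y x == 0)) s) <= 78 * c * 2 ^ m)%N.
  move=> size_Y; apply: leq_trans (leq_add size_Y0 size_Y) _.
  rewrite !mulnDl leq_add2r; apply: leq_trans (leq_addl _ _).
  by rewrite leq_pmulr.
set s' := seq.filter _ s.
have s'_uniq : uniq s' by apply: filter_uniq.
have good x : x \in s' -> has (fun q : nat => ~~ (q %| d2 * Y x)%Z) l.
  rewrite mem_filter => /andP[/= Y0 /sP[_ le_v _]].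
  have [|||q lq ndvd] := @exists_good_prime l (2 ^ b)%N (d2 * Y x) l_uniq l_pr.
  - by move=> q /(allP l_le) /andP[].
  - exact: mulf_neq0.
  - rewrite size_l.
    have le_Y : `|d2 * Y x| <= (A * M ^ 25)%N%:Z.
      rewrite normrM (_ : (A * M ^ 25)%N%:Z
         = (c0 * M ^ 12)%N%:Z * (3 * (c0 * M ^ 12) * M)%N%:Z); last first.
        rewrite -PoszM /A; congr Posz.
        rewrite (_ : M ^ 25 = M ^ 12 * (M ^ 12 * M))%N; last by rewrite -expnSr -expnD.
        by ring.
      apply: ler_pM => //; rewrite /Y.
      apply: le_trans (ler_normD _ _) _; rewrite !normrM.
      have : `|d2| * `|x.2| <= (c0 * M ^ 12)%N%:Z * M%:Z by apply: ler_pM.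
      move: le_d1; set B := (c0 * M ^ 12)%N => le_d1 le_d2v.
      have le_BM : B%:Z <= B%:Z * M%:Z by rewrite ler_peMr // lez_nat.
      have := lerD (lerD le_d2v le_d2v) (le_trans le_d1 le_BM).
      rewrite -mulnA (PoszM 3) (PoszM B) normr_nat -[2 * _ * _]mulrA mulr_natl mulr2n.
      move=> /le_trans; apply; rewrite le_eqVlt; apply/orP; left; apply/eqP; ring.
    apply: leq_ltn_trans (_ : A * M ^ 25 < _)%N; first by rewrite -lez_nat.
    apply: leq_trans (_ : M ^ 26 <= _)%N.
      by rewrite [(M ^ 26)%N]expnS ltn_pmul2r // expn_gt0 M_gt0.
    have -> : ((2 ^ b) ^ 78 = ((2 ^ b) ^ 3) ^ 26)%N by rewrite -[RHS]expnM.
    by rewrite leq_exp2r.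
  - by apply/hasP; exists q.
(* Each point is assigned to the first prime of [l] that is good for it; [prime_bound] applies to
   each fiber. *)
pose f x := nth 0%N l (find (fun q : nat => ~~ (q %| d2 * Y x)%Z) l).
have fP x : x \in s' -> f x \in l /\ ~~ (f x %| d2 * Y x)%Z.
  move=> /good has_x; split; first by rewrite mem_nth // -has_find.
  exact: (nth_find 0%N has_x).
rewrite -size_l -mulnA mulnC.
apply: (@size_fibers _ _ f) => [x /fP[]|q lq] //.
have q_pr := allP l_pr _ lq.
have /andP[lt_q le_q] := allP l_le _ lq.
have [qd2 | ndvd] := boolP (q %| d2)%Z.
  rewrite (_ : [seq x <- s' | f x == q] = [::]) //.
  apply/eqP; rewrite -[_ == _]negbK -has_filter; apply/hasPn => x /fP[_].
  by apply: contra => /eqP->; rewrite dvdz_mulr.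
apply: leq_trans (_ : 2 * (4 * J + 8) * (2 * q) <= _)%N; last first.
  by rewrite /c mulnA leq_mul2l le_q orbT.
apply: (@prime_bound q M J d1 d2 g) => //.
- by rewrite /J addn1.
- apply: leq_ltn_trans (_ : (2 ^ b) ^ (3 * J).-1 < _)%N; last by rewrite ltn_exp2r.
  rewrite -(@leq_exp2r _ _ (3 * e)) ?muln_gt0 // expnMn -/D.
  apply: leq_trans (_ : (M ^ e.+1) ^ (3 * J).-1 <= _)%N; last first.
    by rewrite [X in (_ <= X)%N]expnAC leq_exp2r.
  apply: leq_trans (leq_mul le_DM (leqnn _)) _.
  by rewrite -!expnM -expnS leq_pexp2l.
- exact: filter_uniq.
- move=> x; rewrite mem_filter => /andP[/eqP fx s'x].
  have [_] := fP _ s'x; rewrite fx => ndvdx.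
  move: s'x; rewrite mem_filter => /andP[_ /sP[le_u le_v eqx]]; split=> //.
  by apply: contra ndvdx => dvdY; rewrite dvdz_mull.
Qed.

(** * Lattice points in a box *)

Lemma size_int_box n (D : 'I_n -> nat) (s : seq 'rV[int]_n) :
  uniq s -> (forall x, x \in s -> forall j, `|x 0 j| <= (D j)%:Z) ->
  (size s <= \prod_j (2 * D j).+1)%N.
Proof.
move=> s_uniq le_D.
pose f (x : 'rV[int]_n) : {dffun forall j : 'I_n, 'I_(2 * D j).+1} :=
  [ffun j => inord `|(x 0 j + (D j)%:Z)%R|%N].
rewrite -card_dffun_ord -(size_map f).
rewrite -[leqLHS](card_uniqP _); first exact: max_card.
rewrite map_inj_in_uniq // => x y sx sy /ffunP eq_f.
apply/rowP => j; have := congr1 val (eq_f j); rewrite !ffunE /=.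
have := le_D x sx j; have := le_D y sy j.
move: (x 0 j) (y 0 j) (D j) => a b d le_b le_a.
by rewrite !inordK; lia.
Qed.

Section LatticeCount.

Variables (p n : nat) (c : 'I_n -> 'F_p).

Definition modform (x : 'rV[int]_n) : 'F_p := \sum_j (x 0 j)%:~R * c j.

Lemma modformB x y : modform (x - y) = modform x - modform y.
Proof. by rewrite /modform -sumrB; apply: eq_bigr => j _; rewrite !mxE rmorphB mulrBl. Qed.

Lemma modformD x y : modform (x + y) = modform x + modform y.
Proof. by rewrite /modform -big_split /=; apply: eq_bigr => j _; rewrite !mxE rmorphD mulrDl. Qed.

Lemma modform_mulmx (k : 'rV[int]_n) (W : 'M[int]_n) :
  (forall i, modform (row i W) = 0) -> modform (k *m W) = 0.
Proof.
move=> W0; rewrite /modform.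
under eq_bigr => j _ do rewrite mxE rmorph_sum mulr_suml.
rewrite exchange_big big1 // => i _ /=.
transitivity ((k 0 i)%:~R * modform (row i W)); last by rewrite W0 mulr0.
rewrite /modform mulr_sumr; apply: eq_bigr => j _.
by rewrite mxE rmorphM mulrA.
Qed.

Variables (W : 'M[int]_n) (B : 'I_n -> nat).
Hypotheses (detW : \det W != 0) (leW : forall i j, `|W i j| <= (B j)%:Z).
Hypothesis W0 : forall i, modform (row i W) = 0.

(** Subtract from [x] the combination of the rows of [W] whose coefficients are the integer parts of
    the rational coordinates of [x]; the remaining coefficients lie between 0 and 1. *)
Lemma reduce_modform x : exists2 y, modform y = modform x & forall j, `|y 0 j| <= (n * B j)%N%:Z.
Proof.
pose Wr : 'M[rat]_n := map_mx intr W.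
have uW : Wr \in unitmx by rewrite unitmxE det_map_mx unitfE intr_eq0.
pose t : 'rV[rat]_n := map_mx intr x *m invmx Wr.
pose k : 'rV[int]_n := map_mx Num.floor t.
exists (x - k *m W); first by rewrite modformB modform_mulmx // subr0.
move=> j; rewrite -(ler_int rat) intr_norm.
have -> : ((x - k *m W) 0 j)%:~R = \sum_i (t 0 i - (k 0 i)%:~R) * (W i j)%:~R :> rat.
  under eq_bigr => i _ do rewrite mulrBl.
  rewrite sumrB !mxE rmorphB rmorph_sum /=; congr (_ - _); last first.
    by apply: eq_bigr => i _; rewrite rmorphM.
  have : map_mx intr x = t *m Wr by rewrite mulmxKV.
  move=> /rowP/(_ j); rewrite !mxE => ->.
  by apply: eq_bigr => i _; rewrite !mxE.
apply: le_trans (ler_norm_sum _ _ _) _.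
apply: le_trans (_ : \sum_(i < n) (B j)%:R <= _); last first.
  by rewrite sumr_const card_ord -[leRHS]/((n * B j)%:R) natrM mulr_natl.
apply: ler_sum => i _; rewrite normrM -[leRHS]mul1r; apply: ler_pM => //.
  have /andP[le_k lt_k] := real_floor_itv (num_real (t 0 i)).
  have -> : k 0 i = Num.floor (t 0 i) by rewrite mxE.
  rewrite ger0_norm ?subr_ge0 // lerBlDl; apply: ltW.
  by rewrite -[X in _ + X]/(1%:~R) -rmorphD.
by rewrite -intr_norm -[(B j)%:R]/((B j)%:Z%:~R) ler_int.
Qed.

Hypotheses (p_pr : prime p) (c0 : exists j, c j != 0).

Lemma modform_surj a : exists x, modform x = a.
Proof.
have [j cj] := c0; exists (\row_i (if i == j then (nat_of_ord (a / c j))%:Z else 0)).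
rewrite /modform (bigD1 j) //= big1 => [|i /negPf neq_ij]; rewrite !mxE ?neq_ij ?mul0r //.
rewrite eqxx addr0 -[_%:~R]/((nat_of_ord (a / c j))%:R) natr_Zp.
by rewrite divfK.
Qed.

Lemma lattice_count (s : seq 'rV[int]_n) : uniq s ->
  (forall x, x \in s -> modform x = 0 /\ forall j, `|x 0 j| <= (3 * B j)%N%:Z) ->
  (size s * p <= \prod_j (2 * ((3 + n) * B j)).+1)%N.
Proof.
move=> s_uniq sP.
have exT a : exists y, (modform y == a) && [forall j, `|y 0 j| <= (n * B j)%N%:Z].
  have [x <-] := modform_surj a; have [y yx le_y] := reduce_modform x.
  by exists y; rewrite yx eqxx; apply/forallP.
pose T a := xchoose (exT a).
have TP a : modform (T a) = a /\ forall j, `|T a 0 j| <= (n * B j)%N%:Z.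
  by have /andP[/eqP-> /forallP] := xchooseP (exT a).
(* The translates of [s] by the representatives [T a] of all classes are disjoint. *)
pose L := [seq x + T a | x <- s, a <- enum 'F_p].
have size_L : size L = (size s * p)%N by rewrite size_allpairs -cardE card_Fp.
rewrite -size_L; apply: size_int_box.
  apply: allpairs_uniq => //; first exact: enum_uniq.
  move=> _ _ /allpairsP[[x a] /= [sx _ ->]] /allpairsP[[y b] /= [sy _ ->]] /= eq_xy.
  have := congr1 modform eq_xy; rewrite !modformD.
  have [-> _] := sP x sx; have [-> _] := sP y sy; rewrite !add0r.
  have [-> _] := TP a; have [-> _] := TP b => eq_ab.
  by move: eq_xy; rewrite eq_ab => /addIr->.
move=> _ /allpairsP[[x a] /= [sx _ ->]] j; rewrite mxE.
have [_ /(_ j)] := sP x sx; have [_ /(_ j)] := TP a; rewrite mulnDl PoszD => le_T le_x.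
by apply: le_trans (ler_normD _ _) _; apply: lerD.
Qed.

End LatticeCount.

(** Newton's identities express [6 (x - a) (x - b) (x - c)] through the power sums of [a], [b], [c];
    the factor 6 keeps them integral. *)
Lemma power_sums_root (a b c x y z : int) :
  a + b + c = x + y + z -> a ^+ 2 + b ^+ 2 + c ^+ 2 = x ^+ 2 + y ^+ 2 + z ^+ 2 ->
  a ^+ 3 + b ^+ 3 + c ^+ 3 = x ^+ 3 + y ^+ 3 + z ^+ 3 -> x \in [:: a; b; c].
Proof.
move=> e1 e2 e3.
have : 6 * ((x - a) * (x - b) * (x - c)) = 0.
  have -> : 6 * ((x - a) * (x - b) * (x - c)) =
    6 * x ^+ 3 - 6 * x ^+ 2 * (a + b + c)
    + 3 * x * ((a + b + c) ^+ 2 - (a ^+ 2 + b ^+ 2 + c ^+ 2))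
    - ((a + b + c) ^+ 3 - 3 * (a + b + c) * (a ^+ 2 + b ^+ 2 + c ^+ 2)
       + 2 * (a ^+ 3 + b ^+ 3 + c ^+ 3)) by ring.
  by rewrite e1 e2 e3; ring.
move/eqP; rewrite mulf_eq0 /= !mulf_eq0 !subr_eq0 !inE -orbA.
by [].
Qed.

(** A sum fixes the first three power sums of its triple, so any other triple with the same sum has
    its entries among the same three numbers: at most [3 ^ 3] triples. *)
Lemma triple_sums (n : nat) (w : int -> 'rV[int]_n) (i1 i2 i3 : 'I_n) (U : seq int) :
  uniq U -> (forall u, [/\ w u 0 i1 = u, w u 0 i2 = u ^+ 2 & w u 0 i3 = u ^+ 3]) ->
  (size U ^ 3 <= 27 * size (undup [seq (w x.1 + w x.2.1 + w x.2.2)%R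
      | x <- [seq (u, vw) | u <- U, vw <- [seq (v, u') | v <- U, u' <- U]]]))%N.
Proof.
move=> U_uniq wP; set tr := [seq (u, vw) | u <- U, vw <- _].
have tr_uniq : uniq tr.
  by do 2?[apply: allpairs_uniq => //]; move=> [a b] [c d] _ _ [-> ->].
have <- : size tr = (size U ^ 3)%N by rewrite !size_allpairs !expnS expn0 muln1.
apply: (@size_fibers _ _ (fun x : int * (int * int) => w x.1 + w x.2.1 + w x.2.2)).
  by move=> x trx; rewrite mem_undup; apply/mapP; exists x.
move=> y; rewrite mem_undup => /mapP[[a [b c]] _ ->] /=.
pose abc := [:: a; b; c].
rewrite (_ : 27%N = size [seq (u, vw) | u <- abc, vw <- [seq (v, u') | v <- abc, u' <- abc]]) //.
apply: uniq_leq_size => [|[x [y' z]]]; first exact: filter_uniq.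
rewrite mem_filter => /andP[/eqP /= /rowP eq_w _].
have [a1 a2 a3] := wP a; have [b1 b2 b3] := wP b; have [c1 c2 c3] := wP c.
have [x1 x2 x3] := wP x; have [y1 y2 y3] := wP y'; have [z1 z2 z3] := wP z.
have e1 := eq_w i1; have e2 := eq_w i2; have e3 := eq_w i3.
move: e1 e2 e3; rewrite !mxE a1 a2 a3 b1 b2 b3 c1 c2 c3 x1 x2 x3 y1 y2 y3 z1 z2 z3.
move=> e1 e2 e3.
have abc_x : x \in abc by exact: (power_sums_root (esym e1) (esym e2) (esym e3)).
have abc_y : y' \in abc.
  by apply: (@power_sums_root a b c y' x z); [rewrite -e1|rewrite -e2|rewrite -e3]; ring.
have abc_z : z \in abc.
  by apply: (@power_sums_root a b c z x y'); [rewrite -e1|rewrite -e2|rewrite -e3]; ring.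
by have := allpairs_f pair abc_x (allpairs_f pair abc_y abc_z).
Qed.

(** * The dichotomy for an interval *)

(** There is no constant monomial, because the points are taken relative to a point of the curve,
    which removes the constant term of the equation mod [p]. *)
Definition monomials (x : int * int) : 'rV[int]_5 :=
  \row_j [:: x.1; x.1 ^+ 2; x.1 ^+ 3; x.2; x.2 ^+ 2]`_j.

(** If the rational rank is full, independent rows give [W]. Otherwise Siegel's lemma is applied to
    a maximal independent set of at most [n] rows, so that the bound [B] does not depend on the size
    of [s]; the other rows are combinations of these. *)
Lemma rank_dichotomy (T : Type) n (x0 : T) (w : T -> 'rV[int]_n.+1) (s : seq T) (L B : nat) :
  (forall k, (k < size s)%N -> forall i, `|w (nth x0 s k) 0 i| <= L%:Z) ->
  ((n.+1 * B * L).+1 ^ n < B.+1 ^ n.+1)%N ->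
  (exists2 W : 'M[int]_n.+1, \det W != 0 &
     forall i, exists2 k, (k < size s)%N & row i W = w (nth x0 s k)) \/
  (exists al : 'I_n.+1 -> int, [/\ exists i, al i != 0, forall i, `|al i| <= B%:Z &
     forall k, (k < size s)%N -> \sum_i al i * w (nth x0 s k) 0 i = 0]).
Proof.
move=> le_w lt_B; set m := size s in le_w *.
pose A : 'M[rat]_(m, n.+1) := \matrix_(k, i) (w (nth x0 s k) 0 i)%:~R.
have [full | nfull] := boolP (row_full A).
  left; pose h := fullrankfun full.
  exists (\matrix_(i, j) w (nth x0 s (h i)) 0 j); last first.
    by move=> i; exists (h i) => //; apply/rowP => j; rewrite !mxE.
  rewrite -(intr_eq0 rat) -det_map_mx -unitfE -unitmxE.
  rewrite (_ : map_mx _ _ = rowsub h A); first exact: fullrowsub_unit.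
  by apply/matrixP => i j; rewrite !mxE.
right; have lt_r : (\rank A < n.+1)%N.
  by rewrite ltn_neqAle rank_leq_col andbT.
set r := \rank A in lt_r; pose h : 'I_m ^ r := maxrankfun A.
have [||al [al0 al_le al_ker]] :=
  @siegel_kernel r n.+1 B L (fun k i => w (nth x0 s (h k)) 0 i).
- by move=> k i; apply: le_w.
- apply: leq_ltn_trans lt_B; rewrite leq_pexp2l //.
exists al; split=> // k lt_k.
pose v : 'cV[rat]_n.+1 := \col_i (al i)%:~R.
have Av : A *m v = 0.
  have /submxP[D ->] : (A <= rowsub (maxrankfun A) A)%MS by rewrite eq_maxrowsub.
  rewrite -mulmxA (_ : rowsub h A *m v = 0) ?mulmx0 //.
  apply/colP => k'; have := congr1 (intr : int -> rat) (al_ker k').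
  rewrite !mxE rmorph_sum /= => ker0; rewrite -[RHS]ker0; apply: eq_bigr => i _.
  by rewrite !mxE rmorphM mulrC.
apply/eqP; rewrite -(intr_eq0 rat); apply/eqP.
move/colP/(_ (Ordinal lt_k)): Av; rewrite !mxE rmorph_sum /= => Av.
rewrite -[RHS]Av; apply: eq_bigr => i _; by rewrite !mxE rmorphM mulrC.
Qed.

(** Common factors [p] are removed one at a time, with descent on the size of [al i0]. The resulting
    relation stays nontrivial mod [p]. *)
Lemma primitive_multiple (p n : nat) (al : 'I_n -> int) (i0 : 'I_n) :
  (1 < p)%N -> al i0 != 0 -> exists m be,
    [/\ m != 0, forall i, al i = m * be i & exists i, ~~ (p %| be i)%Z].
Proof.
move=> p_gt1; have [N] := ubnP `|al i0|%N; elim: N al => // N IHN al lt_N al0.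
have [/existsP[i ndvd] | /existsPn dvd] := boolP [exists i, ~~ (p %| al i)%Z].
  by exists 1, al; split=> // [j|]; [rewrite mul1r | exists i].
pose be i := (al i %/ p)%Z.
have alE i : al i = be i * p by rewrite divzK // -[(_ %| _)%Z]negbK.
have be0 : be i0 != 0 by apply: contraNneq al0 => b0; rewrite alE b0 mul0r.
have [||m [be' [m0 beE be'0]]] := IHN be.
- by move: lt_N; rewrite alE abszM ltnS => /(leq_trans _); apply; rewrite ltn_Pmulr // absz_gt0.
- by [].
exists (p%:Z * m), be'; split=> // [|i].
  by rewrite mulf_neq0 //; lia.
by rewrite alE beE mulrC mulrA.
Qed.

(** Subtracting [b5] times the first equation leaves [al v + g(u) = 0]. If [al] is zero, [g] itself
    constrains [u]; otherwise eliminating [v] gives a polynomial [N] of degree at most 6. It is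
    nonzero: [g ^ 2] dominates when [g] has degree at least 2, and the cubic [phi] when not. *)
Lemma curve_intersection (F : fieldType) (phi b : {poly F}) (y1 b4 b5 : F) (s : seq (F * F)) :
  size phi = 4%N -> (size b <= 4)%N -> uniq s ->
  (forall x, x \in s -> x.2 ^+ 2 + y1 * x.2 = phi.[x.1] /\
     b5 * x.2 ^+ 2 + b4 * x.2 + b.[x.1] = 0) ->
  (b4 = y1 * b5 /\ b = - b5 *: phi) \/ (size s <= 12)%N.
Proof.
move=> size_phi size_b s_uniq sP.
pose al := b4 - y1 * b5; pose g := b + b5 *: phi.
have lin x : x \in s -> al * x.2 + g.[x.1] = 0.
  by move=> /sP[e1 e2]; rewrite /g hornerD hornerZ -e1 -[RHS]e2 /al; ring.
have quad x : x \in s -> [/\ 1 *: 'X^2 + y1 *: 'X + (- phi.[x.1])%:P != 0,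
    (size (1 *: 'X^2 + y1 *: 'X + (- phi.[x.1])%:P)%R <= 3)%N
    & root (1 *: 'X^2 + y1 *: 'X + (- phi.[x.1])%:P) x.2].
  move=> /sP[e1 _]; rewrite quadratic_neq0 ?oner_eq0 ?size_quadratic //.
  by rewrite root_quadratic mul1r e1 subrr.
have size_g : (size g <= 4)%N.
  apply: leq_trans (size_polyD _ _) _; rewrite geq_max size_b.
  by apply: leq_trans (size_scale_leq _ _) _; rewrite size_phi.
have count (N : {poly F}) : N != 0 -> (size N <= 7)%N -> (forall x, x \in s -> root N x.1) -> (size s <= 12)%N.
  move=> N0 size_N rootN.
  pose Q (u : F) := 1 *: 'X^2 + y1 *: 'X + (- phi.[u])%:P.
  apply: leq_trans (@plane_count F s N Q s_uniq N0 rootN quad) _.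
  have le6 : ((size N).-1 <= 6)%N by rewrite -subn1 leq_subLR.
  exact: leq_mul (leqnn 2) le6.
have [al0 | al0] := eqVneq al 0.
  have [g0 | g0] := eqVneq g 0.
    left; split; first by apply/eqP; rewrite -subr_eq0 -/al al0.
    by apply/eqP; rewrite scaleNr -addr_eq0 -/g g0.
  right; apply: (count g) => // [|x /lin]; first exact: leq_trans size_g _.
  by rewrite al0 mul0r add0r /root => ->.
right; pose N := g ^+ 2 - ((y1 * al) *: g + (al ^+ 2) *: phi).
have size_al_phi : size (al ^+ 2 *: phi) = 4%N by rewrite size_scale ?expf_neq0.
have size_g2 : (size (g ^+ 2)%R <= 7)%N.
  by rewrite expr2; apply: leq_trans (size_polyM_leq size_g size_g) _.
have size_lin : (size ((y1 * al) *: g + (al ^+ 2) *: phi)%R <= 4)%N.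
  apply: leq_trans (size_polyD _ _) _; rewrite geq_max size_al_phi andbT.
  exact: leq_trans (size_scale_leq _ _) size_g.
apply: (count N) => [||x sx].
- have [le_g2 | lt_2g] := leqP (size g) 2.
    have size_lin' : size ((y1 * al) *: g + (al ^+ 2) *: phi)%R = 4%N.
      rewrite addrC size_polyDl size_al_phi //.
      by apply: leq_ltn_trans (size_scale_leq _ _) _; apply: leq_ltn_trans le_g2 _.
    rewrite -size_poly_gt0 /N addrC size_polyDl size_polyN size_lin' //.
    by rewrite expr2; apply: leq_ltn_trans (size_polyM_leq le_g2 le_g2) _.
  have g0 : g != 0 by rewrite -size_poly_gt0; apply: leq_trans lt_2g.
  have size_g2' : (4 < size (g ^+ 2)%R)%N.
    rewrite expr2 size_mul //; move: lt_2g; case: (size g) => [|[|[|k]]] // _.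
    by rewrite !addSn !addnS.
  rewrite -size_poly_gt0 /N size_polyDl ?size_polyN; first exact: leq_trans size_g2'.
  exact: leq_ltn_trans size_lin _.
- apply: leq_trans (size_polyD _ _) _; rewrite size_polyN geq_max size_g2.
  exact: leq_trans size_lin _.
- have gE : g.[x.1] = - (al * x.2) by apply/eqP; rewrite -addr_eq0 addrC lin.
  have [e1 _] := sP x sx.
  have horner_elim (h : {poly F}) t :
      (h ^+ 2 - ((y1 * al) *: h + (al ^+ 2) *: phi)).[t]
      = h.[t] ^+ 2 - (y1 * al * h.[t] + al ^+ 2 * phi.[t]).
    by rewrite !(hornerD, hornerN, hornerZ, horner_exp).
  rewrite /root /N horner_elim gE -e1.
  by apply/eqP; ring.
Qed.

Definition box5 (K M : nat) (j : 'I_5) : nat := nth 0%N [:: K; K ^ 2; K ^ 3; M; M ^ 2]%N j.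

Lemma monomials_le (K M : nat) x j : `|x.1| <= K%:Z -> `|x.2| <= M%:Z ->
  `|monomials x 0 j| <= (box5 K M j)%:Z.
Proof.
move=> le_u le_v; rewrite mxE /box5.
by case: j => -[|[|[|[|[|k]]]]] //= _; rewrite normrX PoszX lerXn2r // nnegrE.
Qed.

Lemma sum_monomials (R : comNzRingType) (a : 'I_5 -> R) x (i0 := @Ordinal 5 0 isT)
    (i1 := @Ordinal 5 1 isT) (i2 := @Ordinal 5 2 isT) (i3 := @Ordinal 5 3 isT)
    (i4 := @Ordinal 5 4 isT) :
  \sum_i a i * (monomials x 0 i)%:~R =
   a i4 * x.2%:~R ^+ 2 + a i3 * x.2%:~R
   + (a i0 *: 'X + a i1 *: 'X^2 + a i2 *: 'X^3).[x.1%:~R].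
Proof.
rewrite !(hornerD, hornerZ, hornerX, hornerXn).
rewrite !big_ord_recl big_ord0 !mxE /= !rmorphXn /= addr0.
have -> : lift ord0 (lift ord0 (lift ord0 (lift ord0 ord0))) = i4 by apply: val_inj.
have -> : lift ord0 (lift ord0 (lift ord0 ord0)) = i3 :> 'I_5 by apply: val_inj.
have -> : lift ord0 (lift ord0 ord0) = i2 :> 'I_5 by apply: val_inj.
have -> : lift ord0 ord0 = i1 :> 'I_5 by apply: val_inj.
have -> : ord0 = i0 :> 'I_5 by apply: val_inj.
by ring.
Qed.

(** Sums of three vectors lie in the lattice and in a box three times larger, to which
    [lattice_count] applies. The sides of [box5] multiply to [K ^ 6 * M ^ 3], and 17 comes from
    [2 * (3 + 5) + 1]. *)
Lemma spanning_count (p K M : nat) (c : 'I_5 -> 'F_p) (W : 'M[int]_5) (s : seq (int * int)) :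
  prime p -> (0 < K)%N -> (0 < M)%N -> (exists j, c j != 0) -> \det W != 0 ->
  (forall x, x \in s -> [/\ `|x.1| <= K%:Z, `|x.2| <= M%:Z & modform c (monomials x) = 0]) ->
  (forall i, exists2 x, x \in s & row i W = monomials x) ->
  (size (undup [seq x.1 | x <- s]) ^ 3 * p <= 27 * (17 ^ 5 * (K ^ 6 * M ^ 3)))%N.
Proof.
move=> p_pr K_gt0 M_gt0 c0 detW sP WP; set U := undup _.
(* One point is chosen above each abscissa, so that the vector becomes a function of [u] alone, as
   [triple_sums] requires. *)
pose pt u := nth (0, 0) s (index u [seq x.1 | x <- s]).
have ptP u : u \in U -> pt u \in s /\ (pt u).1 = u.
  rewrite mem_undup => Uu.
  have lt_u : (index u [seq x.1 | x <- s] < size s)%N by rewrite -(size_map fst) index_mem.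
  by split; [apply: mem_nth | rewrite -(nth_map _ 0) // nth_index].
pose w u := monomials (u, (pt u).2).
have wP u : u \in U -> modform c (w u) = 0 /\ forall j, `|w u 0 j| <= (box5 K M j)%:Z.
  move=> /ptP[s_pt eq_u]; have -> : w u = monomials (pt u) by rewrite /w -{1}eq_u -surjective_pairing.
  by have [le_u le_v ->] := sP _ s_pt; split=> // j; apply: monomials_le.
pose i1 := @Ordinal 5 0 isT; pose i2 := @Ordinal 5 1 isT; pose i3 := @Ordinal 5 2 isT.
have wE u : [/\ w u 0 i1 = u, w u 0 i2 = u ^+ 2 & w u 0 i3 = u ^+ 3] by rewrite !mxE.
have := @triple_sums 5 w i1 i2 i3 U (undup_uniq _) wE.
set Z := undup _ => le_U.
apply: leq_trans (leq_mul le_U (leqnn p)) _; rewrite -mulnA leq_mul2l /=.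
apply: leq_trans (_ : \prod_j (2 * ((3 + 5) * box5 K M j)).+1 <= _)%N.
  apply: (@lattice_count p 5 c W (box5 K M)) => //.
  - by move=> i j; have [x sx /rowP/(_ j)] := WP i; rewrite mxE => ->; have [? ? _] := sP _ sx; apply: monomials_le.
  - by move=> i; have [x sx ->] := WP i; have [_ _ ->] := sP _ sx.
  - exact: undup_uniq.
  - move=> z; rewrite mem_undup => /mapP[_ /allpairsP[[u1 vw] [/= U1 /allpairsP[[u2 u3] [/= U2 U3 ->]] ->]] ->] /=.
    have [c1 l1] := wP _ U1; have [c2 l2] := wP _ U2; have [c3 l3] := wP _ U3.
    split=> [|j]; first by rewrite !modformD c1 c2 c3 !addr0.
    rewrite mxE [X in X + _]mxE; have := l1 j; have := l2 j; have := l3 j.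
    move: (w u1 0 j) (w u2 0 j) (w u3 0 j) (box5 K M j) => a1 a2 a3 b; lia.
have step B : (0 < B)%N -> ((2 * ((3 + 5) * B)).+1 <= 17 * B)%N by lia.
apply: leq_trans (_ : \prod_j (17 * box5 K M j) <= _)%N.
  by apply: leq_prod => j _; apply: step; case: j => -[|[|[|[|[|k]]]]] //= lt_k; rewrite /box5 /= ?expn_gt0 ?K_gt0 ?M_gt0.
rewrite big_split /= prod_nat_const card_ord leq_mul2l; apply/orP; right.
by rewrite !big_ord_recl big_ord0 /box5 /= muln1; apply: eq_leq; ring.
Qed.

Lemma intr_Fp_inj (p M : nat) (a b : int) : prime p -> (M < p)%N -> `|a - b| <= M%:Z ->
  a%:~R = b%:~R :> 'F_p -> a = b.
Proof.
move=> p_pr lt_Mp le_ab /eqP; rewrite -subr_eq0 -rmorphB -(dvdz_pcharf (pchar_Fp p_pr)) => /dvdzP[t tE].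
apply/eqP; rewrite -subr_eq0; move: le_ab; rewrite tE => le_tp.
have [-> | t0] := eqVneq t 0; first by rewrite mul0r.
nia.
Qed.

(** The choice [B = (6 L) ^ 4] solves [(6 B L) ^ 4 = B ^ 5]. It is used with [L = M ^ 3], whence the
    bound [6 ^ 4 * M ^ 12]. *)
Lemma siegel_size (L B : nat) : (0 < L)%N -> B = (6 ^ 4 * L ^ 4)%N ->
  ((5 * B * L).+1 ^ 4 < B.+1 ^ 5)%N.
Proof.
move=> L_gt0 BE; have B_gt0 : (0 < B)%N by rewrite BE muln_gt0 !expn_gt0 L_gt0.
have BL_gt0 : (0 < B * L)%N by rewrite muln_gt0 B_gt0.
apply: leq_ltn_trans (_ : (6 * B * L) ^ 4 < _)%N.
  by rewrite leq_exp2r // -!mulnA; move: (B * L)%N BL_gt0 => T; lia.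
rewrite (_ : (6 * B * L) ^ 4 = B ^ 5)%N ?ltn_exp2r //.
by rewrite !expnMn mulnAC -BE -expnS.
Qed.

Section CenteredInterval.

(* The points are differences with a fixed one, whence [phi`_0 = 0]; for [f] and
   the fixed point [(x0, y0)] one has [phi = f(X + x0) - f(x0)] and [y1 = 2 y0]. *)
Variables (p K M : nat) (phi : {poly 'F_p}) (y1 : 'F_p) (s : seq (int * int)).
Hypotheses (p_pr : prime p) (K_gt0 : (0 < K)%N) (le_KM : (K <= M)%N).
Hypotheses (size_phi : size phi = 4%N) (phi0 : phi`_0 = 0) (s_uniq : uniq s).
Hypothesis sP : forall x, x \in s -> [/\ `|x.1| <= K%:Z, `|x.2| <= M%:Z
  & x.2%:~R ^+ 2 + y1 * x.2%:~R = phi.[x.1%:~R]].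
Hypothesis s_inj1 : forall x y, x \in s -> y \in s -> x.1%:~R = y.1%:~R :> 'F_p -> x.1 = y.1.
Hypothesis s_inj2 : forall x y, x \in s -> y \in s -> x.2%:~R = y.2%:~R :> 'F_p -> x.2 = y.2.

Let M_gt0 : (0 < M)%N. Proof. exact: leq_trans le_KM. Qed.

Lemma phi_coef0 : phi = phi`_1 *: 'X + phi`_2 *: 'X^2 + phi`_3 *: 'X^3.
Proof.
rewrite -[LHS]coefK size_phi poly_def !big_ord_recl big_ord0 /= phi0 scale0r add0r addr0.
by rewrite /bump /= addrA.
Qed.

Let c (j : 'I_5) : 'F_p := [:: - phi`_1; - phi`_2; - phi`_3; y1; 1]`_j.

Lemma modform_monomials x : x \in s -> modform c (monomials x) = 0.
Proof.
move=> /sP[_ _ eqx]; rewrite /modform; under eq_bigr => j _ do rewrite mulrC.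
rewrite sum_monomials /c /= mul1r eqx {1}phi_coef0 -hornerD.
by rewrite !scaleNr -!opprD subrr horner0.
Qed.

Lemma size_le_abscissae : (size s <= 2 * size (undup [seq x.1 | x <- s]))%N.
Proof.
apply: (@size_fibers _ _ fst) => [x sx|y]; first by rewrite mem_undup map_f.
rewrite mem_undup => /mapP[z sz ->].
pose Q : {poly 'F_p} := 1 *: 'X^2 + y1 *: 'X + (- phi.[z.1%:~R])%:P.
rewrite -ltnS; apply: leq_trans (_ : size Q <= 3)%N; last exact: size_quadratic.
rewrite -(size_map (fun x => x.2%:~R : 'F_p)); apply: max_poly_roots.
- by apply: quadratic_neq0; rewrite oner_eq0.
- apply/allP=> v /mapP[x]; rewrite mem_filter => /andP[/eqP eq_x sx] ->.
  by rewrite root_quadratic mul1r; have [_ _ ->] := sP sx; rewrite eq_x subrr.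
- rewrite map_inj_in_uniq ?filter_uniq // => x t.
  rewrite !mem_filter => /andP[/eqP ex sx] /andP[/eqP et st] /(s_inj2 sx st) e2.
  by rewrite [x]surjective_pairing [t]surjective_pairing e2 ex et.
Qed.

Lemma centered_dichotomy :
  (size (undup [seq x.1 | x <- s]) ^ 3 * p <= 27 * (17 ^ 5 * (K ^ 6 * M ^ 3)))%N
  \/ (size s <= 12)%N
  \/ exists (d1 d2 : int) (g : {poly int}), [/\ size g = 4%N, d2 != 0,
       `|d1| <= (6 ^ 4 * M ^ 12)%N%:Z /\ `|d2| <= (6 ^ 4 * M ^ 12)%N%:Z
     & forall x, x \in s -> d2 * x.2 ^+ 2 + d1 * x.2 + g.[x.1] = 0].
Proof.
have nth_le k : (k < size s)%N -> forall i, `|monomials (nth (0, 0) s k) 0 i| <= (M ^ 3)%N%:Z.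
  move=> lt_k i; have [le_u le_v _] := sP (mem_nth (0, 0) lt_k).
  have le_u' := le_trans le_u (_ : K%:Z <= M%:Z).
  apply: le_trans (monomials_le i (le_u' le_KM) le_v) _; rewrite lez_nat /box5.
  have le1 : (M <= M ^ 3)%N by rewrite -{1}(expn1 M) leq_pexp2l.
  have le2 : (M ^ 2 <= M ^ 3)%N by rewrite leq_pexp2l.
  by case: i => -[|[|[|[|[|i]]]]] //= _.
have [||[W detW WP]|[al [[i0 al0] al_le al_ker]]] :=
  @rank_dichotomy _ 4 (0, 0) monomials s (M ^ 3)%N (6 ^ 4 * M ^ 12)%N.
- exact: nth_le.
- by apply: siegel_size; rewrite ?expn_gt0 ?M_gt0 // -expnM.
- left; apply: (@spanning_count p K M c W s) => //.
  + by exists (@Ordinal 5 4 isT); rewrite oner_eq0.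
  + by move=> x sx; have [? ? _] := sP sx; split=> //; apply: modform_monomials.
  + by move=> i; have [k lt_k ->] := WP i; exists (nth (0, 0) s k) => //; apply: mem_nth.
right; have [m [be [m0 alE [i ndvd]]]] := primitive_multiple (prime_gt1 p_pr) al0.
have be_le j : `|be j| <= (6 ^ 4 * M ^ 12)%N%:Z.
  apply: le_trans (al_le j); rewrite alE normrM ler_peMl //.
  by rewrite -gtz0_ge1 normr_gt0.
pose j0 := @Ordinal 5 0 isT; pose j1 := @Ordinal 5 1 isT; pose j2 := @Ordinal 5 2 isT.
pose j3 := @Ordinal 5 3 isT; pose j4 := @Ordinal 5 4 isT.
pose g : {poly int} := be j0 *: 'X + be j1 *: 'X^2 + be j2 *: 'X^3.
have gc : [/\ g`_1 = be j0, g`_2 = be j1, g`_3 = be j2 & (size g <= 4)%N].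
  split; try by rewrite !coefD !coefZ coefX !coefXn /= !mulr0 ?mulr1 ?add0r ?addr0.
  apply/leq_sizeP => -[|[|[|[|k]]]] // _.
  by rewrite !coefD !coefZ coefX !coefXn /= !mulr0 !addr0.
have eqs x : x \in s -> be j4 * x.2 ^+ 2 + be j3 * x.2 + g.[x.1] = 0.
  move=> sx; have lt_k : (index x s < size s)%N by rewrite index_mem.
  have := al_ker _ lt_k; rewrite nth_index //.
  under eq_bigr => j _ do rewrite alE -mulrA.
  rewrite -mulr_sumr => /eqP; rewrite mulf_eq0 (negPf m0) /= => /eqP sum0.
  rewrite -[RHS]sum0; under [RHS]eq_bigr => j _ do rewrite -[monomials x 0 j]intz.
  by rewrite sum_monomials !intz.
pose b : {poly 'F_p} := map_poly intr g.
pose s' := [seq (x.1%:~R : 'F_p, x.2%:~R : 'F_p) | x <- s].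
have [|||[b4E bE]|] := @curve_intersection 'F_p phi b y1 (be j3)%:~R (be j4)%:~R s' size_phi.
- by apply: leq_trans (size_poly _ _) _; case: gc.
- rewrite map_inj_in_uniq // => x y sx sy [/(s_inj1 sx sy) e1 /(s_inj2 sx sy) e2].
  by rewrite [x]surjective_pairing [y]surjective_pairing e1 e2.
- move=> _ /mapP[x sx ->] /=; split; first by have [_ _] := sP sx.
  have /(congr1 (intr : int -> 'F_p)) := eqs x sx.
  by rewrite !(rmorphD, rmorphM, rmorphXn) /= /b horner_map.
- right; exists (be j3), (be j4), g.
  (* Were [be j4] zero mod [p], proportionality would make all coefficients zero mod [p], against
     primitivity. Hence [b] is a nonzero multiple of [phi], and [g] is truly cubic. *)
  have be4 : (be j4)%:~R != 0 :> 'F_p.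
    apply: contraNneq ndvd => be4; rewrite (dvdz_pcharf (pchar_Fp p_pr)).
    have b0 : b = 0 by rewrite bE be4 oppr0 scale0r.
    have bc k : (g`_k)%:~R = 0 :> 'F_p by rewrite -coef_map -/b b0 coef0.
    case: gc => g1 g2 g3 _; have b3 : (be j3)%:~R = 0 :> 'F_p by rewrite b4E be4 mulr0.
    case: i => -[|[|[|[|[|i]]]]] // lt_i.
    + by have -> : Ordinal lt_i = j0 by [apply: val_inj]; rewrite -g1 bc.
    + by have -> : Ordinal lt_i = j1 by [apply: val_inj]; rewrite -g2 bc.
    + by have -> : Ordinal lt_i = j2 by [apply: val_inj]; rewrite -g3 bc.
    + by rewrite (_ : Ordinal lt_i = j3) ?b3 //; apply: val_inj.
    + by rewrite (_ : Ordinal lt_i = j4) ?be4 //; apply: val_inj.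
  have [_ _ g3 size_g] := gc.
  have b3 : b`_3 != 0.
    rewrite bE coefZ mulf_neq0 ?oppr_eq0 //.
    have : lead_coef phi != 0 by rewrite lead_coef_eq0 -size_poly_gt0 size_phi.
    by rewrite lead_coefE size_phi.
  split=> //.
  + apply/eqP; rewrite eqn_leq size_g ltnNge; apply: contra b3 => /leq_sizeP g0.
    by rewrite coef_map g0.
  + by apply: contraNneq be4 => ->.
- by rewrite size_map => le12; left.
Qed.

End CenteredInterval.

(** [Z] stands for an integer of order at most [M ^ (1/3 + 2 / (3 e))], controlled through its power
    [3 * e] to avoid real exponents. *)
Lemma interval_bound (e : nat) : (0 < e)%N ->
  exists C M0, forall M, (M0 <= M)%N ->
  forall (p : nat) (f : {poly 'F_p}) (K : nat) (X S : int) (s : seq (int * int)),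
    prime p -> size f = 4%N -> (0 < K)%N -> (K <= M)%N -> (M < p)%N ->
    (K ^ 6 * M ^ 2 <= p)%N -> uniq s ->
    (forall x, x \in s -> [/\ X < x.1 <= X + K%:Z, S < x.2 <= S + M%:Z
       & x.2%:~R ^+ 2 = f.[x.1%:~R]]) ->
    exists Z, (Z ^ (3 * e) <= C * M ^ (e + 2))%N /\ (size s <= C * Z)%N.
Proof.
move=> e_gt0; have [C1 [M0 M0P]] := @bombieri_pila e (6 ^ 4)%N e_gt0.
have [A AE] : exists A, A = (27 * 17 ^ 5)%N by exists (27 * 17 ^ 5)%N.
exists (C1 + A ^ e + 12 + 2)%N, M0 => M le_M p f K X S s p_pr size_f K_gt0 le_KM lt_Mp le_p s_uniq sP.
have M_gt0 : (0 < M)%N by apply: leq_trans le_KM.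
case s_eq: s => [|o s0]; first by exists 0%N; rewrite exp0n ?muln_gt0.
have so : o \in s by rewrite s_eq mem_head.
rewrite -s_eq {s0 s_eq}.
pose shift (x : int * int) := (x.1 - o.1, x.2 - o.2).
pose s1 := [seq shift x | x <- s].
have shift_inj : injective shift.
  by move=> [a b] [c d] [/addIr-> /addIr->].
have s1_uniq : uniq s1 by rewrite map_inj_uniq.
rewrite -(size_map shift) -/s1.
pose phi := (f \Po ('X + (o.1%:~R)%:P)) - (f.[o.1%:~R])%:P.
have size_phi : size phi = 4%N.
  have size_f' : size (f \Po ('X + (o.1%:~R)%:P)) = 4%N by rewrite size_comp_poly2 ?size_XaddC.
  rewrite size_polyDl size_f' // size_polyN.
  by apply: leq_ltn_trans (size_polyC_leq1 _) _.
have phi0 : phi`_0 = 0.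
  by rewrite -horner_coef0 !(hornerD, hornerN, horner_comp, hornerC, hornerX) add0r subrr.
have diff1 x y : x \in s -> y \in s -> `|x.1 - y.1| <= K%:Z.
  by move=> /sP[/andP[? ?] _ _] /sP[/andP[? ?] _ _]; lia.
have diff2 x y : x \in s -> y \in s -> `|x.2 - y.2| <= M%:Z.
  by move=> /sP[_ /andP[? ?] _] /sP[_ /andP[? ?] _]; lia.
have s1P x : x \in s1 -> [/\ `|x.1| <= K%:Z, `|x.2| <= M%:Z
    & x.2%:~R ^+ 2 + (2 * o.2%:~R) * x.2%:~R = phi.[x.1%:~R]].
  move=> /mapP[z sz ->] /=; split; [exact: diff1 | exact: diff2 |].
  rewrite !(hornerD, hornerN, horner_comp, hornerC, hornerX) -[X in X%:~R + _ ]/(z.1 - o.1).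
  rewrite !rmorphB /= subrK; have [_ _ <-] := sP z sz; have [_ _ <-] := sP o so.
  by ring.
have lt_Kp : (K < p)%N by apply: leq_ltn_trans lt_Mp.
have inj1 x y : x \in s1 -> y \in s1 -> x.1%:~R = y.1%:~R :> 'F_p -> x.1 = y.1.
  move=> /mapP[z sz ->] /mapP[t st ->] /=; apply: (intr_Fp_inj p_pr lt_Kp).
  by rewrite opprB addrA subrK; apply: diff1.
have inj2 x y : x \in s1 -> y \in s1 -> x.2%:~R = y.2%:~R :> 'F_p -> x.2 = y.2.
  move=> /mapP[z sz ->] /mapP[t st ->] /=; apply: (intr_Fp_inj p_pr lt_Mp).
  by rewrite opprB addrA subrK; apply: diff2.
have [le_U | [le12 | [d1 [d2 [g [size_g d20 [le_d1 le_d2] eqs]]]]]] :=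
  centered_dichotomy p_pr K_gt0 le_KM size_phi phi0 s1_uniq s1P inj1 inj2.
(* Spanning case: [K ^ 6 * M ^ 2 <= p] turns the lattice count into [U ^ 3 <= A * M] for the number
   [U] of abscissae. *)
- exists (size (undup [seq x.1 | x <- s1])); split; last first.
    apply: leq_trans (size_le_abscissae s1_uniq s1P inj2) _.
    by rewrite leq_mul2r leq_addl orbT.
  set U := size _ in le_U *.
  have le_U3 : (U ^ 3 <= A * M)%N.
    rewrite -(@leq_pmul2r p) ?prime_gt0 //; apply: leq_trans le_U _.
    rewrite mulnA -AE -mulnA leq_mul2l; apply/orP; right.
    by rewrite (expnSr M 2) mulnA mulnC leq_mul2l le_p orbT.
  rewrite expnM; apply: leq_trans (_ : (A * M) ^ e <= _)%N; first by rewrite leq_exp2r.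
  rewrite expnMn; apply: leq_mul; last by rewrite leq_pexp2l // leq_addr.
  by rewrite -!addnA addnCA leq_addr.
- exists 1%N; rewrite exp1n muln1; split.
    by rewrite muln_gt0 expn_gt0 M_gt0 andbT addn_gt0 orbT.
  by apply: leq_trans le12 _; rewrite -addnA addnCA leq_addr.
- have [|Z [le_Z size_Z]] := M0P M le_M d1 d2 g s1 size_g d20 le_d1 le_d2 s1_uniq.
    move=> x sx; have [le_u le_v _] := s1P x sx; split=> //; last exact: eqs.
    by apply: le_trans le_u _; rewrite lez_nat.
  exists Z; split; [apply: leq_trans le_Z _ | apply: leq_trans size_Z _].
    by rewrite leq_mul2r -!addnA leq_addr orbT.
  by rewrite leq_mul2r -!addnA leq_addr orbT.
Qed.

(** * Covering by intervals *)

Lemma interval_bound_real (K : realType) (delta : K) : 0 < delta ->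
  exists (C : K) M0, 1 <= C /\ forall M, (M0 <= M)%N ->
  forall (p : nat) (f : {poly 'F_p}) (H : nat) (X S : int) (s : seq (int * int)),
    prime p -> size f = 4%N -> (0 < H)%N -> (H <= M)%N -> (M < p)%N ->
    (H ^ 6 * M ^ 2 <= p)%N -> uniq s ->
    (forall x, x \in s -> [/\ X < x.1 <= X + H%:Z, S < x.2 <= S + M%:Z
       & x.2%:~R ^+ 2 = f.[x.1%:~R]]) ->
    (size s)%:R <= C * M%:R `^ (1 / 3 + delta).
Proof.
(* This makes [2 / e <= delta], so that the exponent [(e + 2) / (3 e)] is at most [1/3 + delta]. *)
move=> delta_gt0; pose e := (Num.truncn (2 / delta)).+1.
have e_delta : 2 <= e%:R * delta.
  by rewrite -ler_pdivrMr //; apply/ltW/truncnS_gt.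
have [C0 [M0 M0P]] := @interval_bound e isT.
exists (C0.+1 * C0.+1)%:R, M0; split; first by rewrite ler1n.
move=> M le_M p f H X S s p_pr size_f H_gt0 le_HM lt_Mp le_p s_uniq sP.
have [Z [le_Z size_Z]] := M0P M le_M p f H X S s p_pr size_f H_gt0 le_HM lt_Mp le_p s_uniq sP.
have M_ge1 : 1 <= M%:R :> K by rewrite ler1n; apply: leq_trans le_HM.
have le_ZR : Z%:R <= C0.+1%:R * M%:R `^ (1 / 3 + delta).
  rewrite -(@ler_pXn2r _ (3 * e)) ?nnegrE ?mulr_ge0 ?powR_ge0 //.
  rewrite exprMn -(powR_mulrn _ (powR_ge0 _ _)) -powRrM.
  apply: le_trans (_ : (C0 * M ^ (e + 2))%:R <= _); first by rewrite -natrX ler_nat.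
  rewrite natrM; apply: ler_pM => //.
    rewrite -natrX ler_nat; apply: leq_trans (leqnSn C0) _.
    by rewrite -{1}(expn1 C0.+1) leq_pexp2l.
  rewrite natrX -(powR_mulrn _ (ler0n _ _)); apply: ler_powR => //.
  by rewrite natrD natrM; lra.
apply: le_trans (_ : (C0 * Z)%:R <= _); first by rewrite ler_nat.
rewrite natrM (natrM _ C0.+1) -mulrA; apply: ler_pM => //; first by rewrite ler_nat.
Qed.

Lemma box_pointsE (p : nat) (f : {poly 'F_p}) (M : nat) (R S : int) :
  exists s : seq (int * int), [/\ uniq s, size s = box_points f M R S &
    forall x, x \in s -> [/\ R < x.1 <= R + M%:Z, S < x.2 <= S + M%:Z
       & x.2%:~R ^+ 2 = f.[x.1%:~R]]].
Proof.
rewrite /box_points; set A := finset _.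
pose h (ij : 'I_M * 'I_M) := (R + ij.1.+1%:Z, S + ij.2.+1%:Z).
exists [seq h ij | ij <- enum A]; split.
- rewrite map_inj_uniq ?enum_uniq // => -[i j] [i' j'] [e1 e2].
  by congr pair; apply: val_inj => /=; lia.
- by rewrite size_map -cardE.
- move=> x /mapP[[i j]]; rewrite mem_enum inE /= => /eqP eq_ij ->.
  by split=> //=; have := ltn_ord i; have := ltn_ord j; lia.
Qed.

Lemma absz_window (a R : int) (M : nat) : R < a <= R + M%:Z -> (absz (a - R - 1)%R < M)%N.
Proof. by lia. Qed.

Lemma absz_window_inj (a b R : int) (y : nat) : R < a -> R < b ->
  absz (a - R - 1)%R = y -> absz (b - R - 1)%R = y -> a = b.
Proof. by lia. Qed.

Lemma dist_window (a b R : int) (M : nat) :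
  R < a <= R + M%:Z -> R < b <= R + M%:Z -> `|a - b| <= M%:Z.
Proof. by lia. Qed.

(** Each abscissa carries at most two ordinates, since the window is shorter than [p]. *)
Lemma trivial_bound (p : nat) (f : {poly 'F_p}) (M : nat) (S : int) (s : seq (int * int)) (R : int) :
  prime p -> (M < p)%N -> uniq s ->
  (forall x, x \in s -> [/\ R < x.1 <= R + M%:Z, S < x.2 <= S + M%:Z
       & x.2%:~R ^+ 2 = f.[x.1%:~R]]) ->
  (size s <= 2 * M)%N.
Proof.
move=> p_pr lt_Mp s_uniq sP.
rewrite -[X in (_ <= 2 * X)%N](size_iota 0).
apply: (@size_fibers _ _ (fun x => absz (x.1 - R - 1)%R)) => [x /sP[win _ _]|y _].
  by rewrite mem_iota; apply: absz_window.
pose s' := [seq x <- s | absz (x.1 - R - 1)%R == y]; rewrite -/s'.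
case s'E: s' => [//|o t]; rewrite -s'E.
have s'o : o \in s' by rewrite s'E mem_head.
have eq1 x : x \in s' -> x.1 = o.1.
  move: s'o; rewrite !mem_filter => /andP[/eqP eo /sP[/andP[lt_o _] _ _]].
  by move=> /andP[/eqP ex /sP[/andP[lt_x _] _ _]]; apply: absz_window_inj lt_x lt_o ex eo.
pose Q : {poly 'F_p} := 1 *: 'X^2 + 0 *: 'X + (- f.[o.1%:~R])%:P.
rewrite -ltnS; apply: leq_trans (_ : size Q <= 3)%N; last exact: size_quadratic.
rewrite -(size_map (fun x => x.2%:~R : 'F_p)); apply: max_poly_roots.
- by apply: quadratic_neq0; rewrite oner_eq0.
- apply/allP=> v /mapP[x s'x ->]; rewrite root_quadratic mul1r mul0r addr0.
  rewrite -(eq1 x s'x); move: s'x; rewrite mem_filter => /andP[_ /sP[_ _ ->]].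
  by rewrite subrr.
- rewrite map_inj_in_uniq ?filter_uniq // => x z s'x s'z eq2.
  rewrite [x]surjective_pairing [z]surjective_pairing (eq1 x) // (eq1 z) //; congr pair.
  move: s'x s'z; rewrite !mem_filter => /andP[_ /sP[_ win_x _]] /andP[_ /sP[_ win_z _]].
  by apply: (intr_Fp_inj p_pr lt_Mp) eq2; apply: dist_window win_x win_z.
Qed.

Lemma leq_count_in (T : eqType) (a b : pred T) (s : seq T) :
  {in s, forall x, a x -> b x} -> (count a s <= count b s)%N.
Proof.
move=> ab; rewrite (@eq_in_count _ a (predI (mem s) a)) => [|x sx /=]; last by rewrite sx.
by apply: sub_count => x /= /andP[sx /(ab x sx)].
Qed.

Lemma block_window (a R : int) (H : nat) : (0 < H)%N -> R < a ->
  let y := (absz (a - R - 1)%R %/ H)%N in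
  R + (y * H)%N%:Z < a <= R + (y * H)%N%:Z + H%:Z.
Proof.
move=> H_gt0 lt_Ra /=; set d := absz _.
have := leq_trunc_div d H; have := ltn_ceil d H_gt0; rewrite mulSn.
have aE : a = R + d%:Z + 1 by rewrite /d; lia.
by move: (_ * H)%N => b; lia.
Qed.

Lemma block_bound (M H T : nat) (R : int) (s : seq (int * int)) : (0 < H)%N ->
  (forall x, x \in s -> R < x.1 <= R + M%:Z) ->
  (forall X : int, size [seq x <- s | (X < x.1 <= X + H%:Z)%R] <= T)%N ->
  (size s <= T * (M %/ H).+1)%N.
Proof.
move=> H_gt0 sP le_T; rewrite -[X in (_ <= _ * X)%N](size_iota 0).
apply: (@size_fibers _ _ (fun x => (absz (x.1 - R - 1)%R %/ H)%N)) => [x /sP win|y _].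
  by rewrite mem_iota /= ltnS; apply: leq_div2r; apply/ltnW/absz_window.
apply: leq_trans (le_T (R + (y * H)%N%:Z)).
rewrite !size_filter; apply: leq_count_in => x sx /eqP <-.
by have /andP[lt_Rx _] := sP _ sx; apply: block_window.
Qed.

(** The value 1 is admissible as [M ^ 2 <= p], and admissible lengths are at most [M] as
    [p < M ^ 8]. Maximality bounds [p ^ (1/6)] by [(H + 1) M ^ (1/3)]. *)
Lemma max_block_length (p M : nat) : (0 < M)%N -> (M ^ 2 <= p)%N -> (p < M ^ 8)%N ->
  exists H, [/\ (0 < H)%N, (H <= M)%N, (H ^ 6 * M ^ 2 <= p)%N & (p < H.+1 ^ 6 * M ^ 2)%N].
Proof.
move=> M_gt0 le_Mp lt_pM.
have exP : exists H, (H ^ 6 * M ^ 2 <= p)%N by exists 1%N; rewrite exp1n mul1n.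
have le_P H : (H ^ 6 * M ^ 2 <= p -> H <= M)%N.
  move=> le_H; rewrite leqNgt; apply/negP => lt_MH; move: lt_pM; rewrite ltnNge; case/negP.
  apply: leq_trans le_H; rewrite (expnD M 6 2) leq_mul2r; apply/orP; right.
  by rewrite leq_exp2r // ltnW.
have [H le_H max_H] := ex_maxnP exP le_P.
exists H; split=> //; first by apply: max_H; rewrite exp1n mul1n.
  exact: le_P.
by rewrite ltnNge; apply/negP => /max_H; rewrite ltnn.
Qed.

Theorem theorem1 (K : realType) :
  forall eps : K, 0 < eps ->
  exists M0 : nat,
  forall (p : nat) (f : {poly 'F_p}) (R S : int) (M : nat),
    prime p -> size f = 4%N ->
    (1 <= M)%N -> (M < p)%N -> (M0 <= M)%N ->
    (box_points f M R S)%:R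
      < M%:R `^ (1 / 3 + eps) + M%:R `^ (5 / 3 + eps) / p%:R `^ (1 / 6) :> K.
Proof.
(* One half of [eps] goes to the bound on an interval, the other to absorbing constants through
   [4 * C <= M ^ delta]. *)
move=> eps eps_gt0; pose delta := eps / 2.
have delta_gt0 : 0 < delta by rewrite divr_gt0.
have [C [M1 [C_ge1 CP]]] := interval_bound_real delta_gt0.
exists (M1 + (Num.truncn ((4 * C) `^ delta^-1)).+1)%N => p f R S M p_pr size_f M_gt0 lt_Mp le_M.
have [s [s_uniq <- sP]] := box_pointsE f M R S.
have {}CP := CP M (leq_trans (leq_addr _ _) le_M) p f.
have C_gt0 : 0 < C by apply: lt_le_trans C_ge1.
have le_C : 4 * C <= M%:R `^ delta.
  have -> : 4 * C = ((4 * C) `^ delta^-1) `^ delta.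
    by rewrite -powRrM mulVf ?gt_eqF // powRr1 // mulr_ge0 // ltW.
  apply: ge0_ler_powR; rewrite ?nnegrE ?powR_ge0 ?ltW ?ltr0n //.
  by apply: lt_le_trans (truncnS_gt _) _; rewrite ler_nat; exact: leq_trans (leq_addl _ _) le_M.
have M_neq0 : M%:R != 0 :> K by rewrite pnatr_eq0 -lt0n.
have MD r t : M%:R `^ (r + t) = M%:R `^ r * M%:R `^ t :> K by rewrite powRD // M_neq0 implybT.
have Mpos r : 0 < M%:R `^ r :> K by rewrite powR_gt0 // ltr0n.
have q_gt0 : 0 < p%:R `^ (1 / 6) :> K by rewrite powR_gt0 // ltr0n prime_gt0.
have M1E : M%:R `^ 1 = M%:R :> K by rewrite powRr1.
have epsE : eps = delta + delta by rewrite /delta -splitr.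
have pow6 (n k : nat) : (n%:R ^+ (6 * k)) `^ (1 / 6) = n%:R ^+ k :> K.
  by rewrite mulnC exprM -powR_mulrn ?exprn_ge0 // -powRrM mul1r mulfV // powRr1 // exprn_ge0.
(* For [p <= M ^ 4] the second term is at least [2 M], the trivial bound; strictness comes from the
   positive first term. *)
have [le_pM | lt_Mp4] := leqP p (M ^ 4).
  apply: le_lt_trans (_ : (2 * M)%:R < _).
    by rewrite ler_nat; apply: trivial_bound p_pr lt_Mp s_uniq sP.
  apply: ltr_pwDl => //.
  rewrite ler_pdivlMr // natrM.
  have le_q : p%:R `^ (1 / 6) <= M%:R `^ (2 / 3) :> K.
    apply: le_trans (_ : (M ^ 4)%:R `^ (1 / 6) <= _).
      by apply: ge0_ler_powR; rewrite ?nnegrE ?ler0n ?ler_nat //; lra.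
    rewrite natrX -powR_mulrn // -powRrM; apply: ler_powR; first by rewrite ler1n.
    by lra.
  have -> : 5 / 3 + eps = delta + (1 + (2 / 3 + delta)) :> K by rewrite epsE; lra.
  rewrite !MD M1E mulrA.
  have ge1 : 1 <= M%:R `^ delta :> K by lra.
  apply: ler_pM; rewrite ?mulr_ge0 ?(ltW q_gt0) //.
    by rewrite ler_pM2r ?ltr0n //; lra.
  by apply: le_trans le_q _; rewrite ler_peMr // ltW.
(* For [p >= M ^ 8] the whole range is a single admissible interval, and the first term suffices. *)
have [le_p | lt_pM] := leqP (M ^ 8) p.
  apply: le_lt_trans (CP M R S s p_pr size_f M_gt0 (leqnn M) lt_Mp _ s_uniq sP) _.
    by rewrite -expnD.
  rewrite epsE addrA [X in _ < X + _]MD mulrC.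
  rewrite -[ltLHS]addr0; apply: ltr_leD; last by rewrite ltW // divr_gt0.
  by rewrite ltr_pM2l //; lra.
(* In the middle range there are [O(M / H)] blocks of [M ^ (1/3 + delta)] points up to a constant,
   and [1 / H] is [O(M ^ (1/3) / p ^ (1/6))]; the product gives the second term. *)
have le_M2 : (M ^ 2 <= p)%N.
  by apply: leq_trans (ltnW lt_Mp4); rewrite leq_pexp2l.
have [H [H_gt0 le_HM le_Hp lt_pH]] := max_block_length M_gt0 le_M2 lt_pM.
pose T := Num.truncn (C * M%:R `^ (1 / 3 + delta)).
have le_T : T%:R <= C * M%:R `^ (1 / 3 + delta).
  by rewrite truncn_le mulr_ge0 ?ltW.
have size_s : (size s <= T * (M %/ H).+1)%N.
  apply: (@block_bound M H T R s H_gt0) => [x /sP[]//|X].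
  rewrite truncn_ge_nat; last by rewrite mulr_ge0 // ltW.
  apply: (CP H X S) => //; first exact: filter_uniq.
  by move=> x; rewrite mem_filter => /andP[win /sP[_ ? ?]].
(* From [1 <= H <= M], the two factors are at most [2 M / H] and [2 H]. *)
have blocks : ((M %/ H).+1 * H.+1 <= 4 * M)%N.
  by have := leq_trunc_div M H; nia.
have le_q : p%:R `^ (1 / 6) <= H.+1%:R * M%:R `^ (1 / 3) :> K.
  apply: le_trans (_ : (H.+1 ^ 6 * M ^ 2)%:R `^ (1 / 6) <= _).
    by apply: ge0_ler_powR; rewrite ?nnegrE ?ler0n ?ler_nat 1?ltnW //; lra.
  rewrite natrM powRM // !natrX (pow6 _ 1%N) expr1 -powR_mulrn // -powRrM.
  by rewrite ler_pM2l // ler_powR ?ler1n //; lra.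
apply: ltr_pwDl => //; rewrite ler_pdivlMr //.
apply: le_trans (_ : (T * (M %/ H).+1)%:R * (H.+1%:R * M%:R `^ (1 / 3)) <= _).
  by apply: ler_pM; rewrite ?ler_nat // ltW.
have -> : (T * (M %/ H).+1)%:R * (H.+1%:R * M%:R `^ (1 / 3))
    = T%:R * ((M %/ H).+1 * H.+1)%:R * M%:R `^ (1 / 3) :> K by rewrite !natrM; ring.
apply: le_trans (_ : C * M%:R `^ (1 / 3 + delta) * (4 * M)%:R * M%:R `^ (1 / 3) <= _).
  by rewrite ler_pM2r //; apply: ler_pM; rewrite ?ler_nat.
have -> : 5 / 3 + eps = delta + ((1 / 3 + delta) + (1 + 1 / 3)) :> K by rewrite epsE; lra.
rewrite !MD M1E natrM.
set a := M%:R `^ (1 / 3); set d := M%:R `^ delta in le_C *.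
have -> : C * (a * d) * (4 * M%:R) * a = 4 * C * (a * d * (M%:R * a)) by ring.
have MR_gt0 : 0 < M%:R :> K by rewrite ltr0n.
by rewrite ler_pM2r // !mulr_gt0 ?Mpos.
Qed.
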